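(* There are absolute constants $C_1$ (sufficiently large) and $C>0$ such that if $C_1\log n/n\le p<1$ and $0<\varepsilon<1$, then the estimator $\hat\theta$ defined in the context is edge-level $(\varepsilon,0)$-differentially private and satisfies $$\sup_{\theta\in\Theta}R_\theta(\hat\theta)\ \le\ C\left(\frac1p+\min\left\{n,\frac1{np^2\varepsilon^2}\right\}\right).$$
   Context: Bradley–Terry–Luce model: there are $n\ge2$ items. Each pair $1\le i<j\le n$ is included in the random edge set $\mathcal G$ independently with probability $p\in(0,1)$. Given $\mathcal G$, outcomes $Y_{ij}\in\{0,1\}$, $(i,j)\in\mathcal G$, are independent with $\mathbb P(Y_{ij}=1)=e^{\theta_i}/(e^{\theta_i}+e^{\theta_j})$. Parameter space: $\Theta=\{\theta\in\mathbb R^n:\|\theta\|_\infty\le1,\ \mathbf 1^\top\theta=0\}$. Edge-level privacy: the graph is public; two data sets are adjacent if they have the same graph and differ in the outcome of one observed comparison. $M$ is edge-level $(\varepsilon,\delta)$-differentially private if for all adjacent $(y,\mathcal G),(y',\mathcal G)$ and measurable $S$, $\mathbb P(M(y,\mathcal G)\in S)\le e^\varepsilon\mathbb P(M(y',\mathcal G)\in S)+\delta$ (probability over $M$ only). Risk: $R_\theta(M)=\mathbb E_{\mathcal G}\mathbb E_{\mathbf Y\mid\theta,\mathcal G}\|M(\mathbf Y,\mathcal G)-\theta\|_2^2$. Estimator $\hat\theta$: let $\phi(t)=\log(1+e^t)$, $\kappa_0=e^{-2}/(1+e^{-2})^2$, and $\bar\phi(t)=\phi(t)$ for $|t|\le2$;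 $\bar\phi(t)=\phi(-2)+\phi'(-2)(t+2)+\kappa_0(t+2)^2/2$ for $t<-2$; $\bar\phi(t)=\phi(2)+\phi'(2)(t-2)+\kappa_0(t-2)^2/2$ for $t>2$. Let $x_{ij}=e_i-e_j$ ($e_i$ standard basis vectors), $\bar{\mathcal L}(\theta;y)=\sum_{(i,j)\in\mathcal G}[-y_{ij}x_{ij}^\top\theta+\bar\phi(x_{ij}^\top\theta)]$, $L_{\mathcal G}=\sum_{(i,j)\in\mathcal G}x_{ij}x_{ij}^\top$, $P=I-\mathbf 1\mathbf 1^\top/n$, and let $\lambda_2(L_{\mathcal G})$ be the second smallest eigenvalue of $L_{\mathcal G}$. If $\lambda_2(L_{\mathcal G})<e^{-1}np$, set $\hat\theta=0$. Otherwise draw independent $W_1,\dots,W_n$ with density $w\mapsto(\varepsilon/4)\exp(-\varepsilon|w|/2)$, put $\mathbf B=P\mathbf W$, and set $$\tilde\theta=\arg\min_{\theta\in\mathbf 1^\perp}\{\bar{\mathcal L}(\theta;y)+\langle\mathbf B,\theta\rangle\},\qquad \hat\theta=\Pi_\Theta(\tilde\theta),$$ where $\Pi_\Theta$ is Euclidean projection onto $\Theta$ and $\mathbf 1^\perp=\{\theta:\mathbf 1^\top\theta=0\}$. *)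

(* Defs.v *)
From HB Require Import structures.
From mathcomp Require Export all_boot all_order all_algebra.
From mathcomp Require Export all_classical all_reals all_analysis.

Set Implicit Arguments.
Unset Strict Implicit.
Unset Printing Implicit Defensive.

Import Order.TTheory GRing.Theory Num.Theory.
Import numFieldNormedType.Exports.

Local Open Scope classical_set_scope.
Local Open Scope ring_scope.

(* A pair (i, j) with i < j; a graph is a set of such pairs. *)
Notation edge n := {e : 'I_n * 'I_n | (e.1 < e.2)%N}.
Notation graph n := {set edge n}.

(* One outcome per pair that is actually compared; y e = true encodes
   Y_ij = 1 for e = (i, j). *)
Notation outcomes g := {ffun {e | e \in g} -> bool}.

Definition adjacent n (g : graph n) (y y' : outcomes g) : Prop :=
  exists e, y e != y' e /\ forall f, f != e -> y f = y' f.

Definition dot (R : realType) n (u v : 'cV[R]_n) : R := (u^T *m v) 0 0.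

Definition sqnorm2 (R : realType) n (u : 'cV[R]_n) : R := dot u u.

Definition ones (R : realType) n : 'cV[R]_n := const_mx 1.

Definition orth1 (R : realType) n : set 'cV[R]_n :=
  [set theta | dot (ones R n) theta = 0].

(* The norm `|_| of the library on matrices is the sup norm. *)
Definition Theta (R : realType) n : set 'cV[R]_n :=
  [set theta | `|theta| <= 1 /\ orth1 theta].

Definition borel_vec (R : realType) n := g_sigma_algebraType (@open 'cV[R]_n).

(* A minimizer of f over D, and the junk value 0 if there is none. *)
Definition argmin_over (R : realType) n (D : set 'cV[R]_n)
    (f : 'cV[R]_n -> R) : 'cV[R]_n :=
  xget 0 [set x | D x /\ forall z, D z -> f x <= f z].

Definition proj_onto (R : realType) n (D : set 'cV[R]_n) (x : 'cV[R]_n) :=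
  argmin_over D (fun z => sqnorm2 (z - x)).

(* The nondecreasing sequence of the roots of the characteristic polynomial,
   listed with multiplicity; it exists and is unique when A is symmetric. *)
Definition spectrum (R : realType) n (A : 'M[R]_n) : seq R :=
  xget [::] [set s | sorted <=%R s /\
                     char_poly A = \prod_(a <- s) ('X - a%:P)].

Definition lambda2 (R : realType) n (A : 'M[R]_n) : R := (spectrum A)`_1.

Definition btl_prob (R : realType) n (theta : 'cV[R]_n) (e : edge n) : R :=
  expR (theta (val e).1 0) /
    (expR (theta (val e).1 0) + expR (theta (val e).2 0)).

Definition graph_pmf (R : realType) n (p : R) (g : graph n) : R :=
  \prod_(e : edge n) bernoulli_pmf p (e \in g).

Definition outcome_pmf (R : realType) n (theta : 'cV[R]_n) (g : graph n)
    (y : outcomes g) : R :=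
  \prod_(e : {e | e \in g}) bernoulli_pmf (btl_prob theta (val e)) (y e).

Section mechanisms.
Context (R : realType) (n : nat) (d : measure_display) (Om : measurableType d).

(* A point of Om is a value of the internal randomness of the mechanism. *)
Definition mechanism := forall g : graph n, outcomes g -> Om -> 'cV[R]_n.

Variable Q : probability Om R.

(* (eps, delta)-differential privacy with respect to the outcome of one
   comparison.  That the output is a random vector is part of the definition:
   the probabilities below would otherwise be meaningless. *)
Definition edge_level_dp (eps delta : R) (M : mechanism) : Prop :=
  (forall (g : graph n) (y : outcomes g),
     measurable_fun setT (M g y : Om -> borel_vec R n)) /\
  (forall (g : graph n) (y y' : outcomes g), adjacent y y' ->
     forall S : set (borel_vec R n), measurable S ->
     (Q (M g y @^-1` S) <= (expR eps)%:E * Q (M g y' @^-1` S) + delta%:E)%E).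

Definition risk (p : R) (theta : 'cV[R]_n) (M : mechanism) : \bar R :=
  (\sum_(g : graph n) (graph_pmf p g)%:E *
     \sum_(y : outcomes g) (outcome_pmf theta y)%:E *
       'E_Q[fun w => sqnorm2 (M g y w - theta)])%E.

Definition mutually_independent (X : 'I_n -> {RV Q >-> R}) : Prop :=
  forall (J : {set 'I_n}) (A : 'I_n -> set R), (forall i, measurable (A i)) ->
    Q (\bigcap_(i in [set` J]) (X i @^-1` A i)) =
      (\prod_(i in J) Q (X i @^-1` A i))%E.

Definition has_density (X : {RV Q >-> R}) (f : R -> R) : Prop :=
  forall A : set R, measurable A ->
    distribution Q X A = (\int[lebesgue_measure]_(x in A) (f x)%:E)%E.

End mechanisms.

Definition phi (R : realType) (t : R) : R := ln (1 + expR t).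

Definition kappa0 (R : realType) : R := expR (- 2) / (1 + expR (- 2)) ^+ 2.

Definition phibar (R : realType) (t : R) : R :=
  if t < - 2 then
    phi (- 2) + derive1 (@phi R) (- 2) * (t + 2) + kappa0 R * (t + 2) ^+ 2 / 2
  else if 2 < t then
    phi 2 + derive1 (@phi R) 2 * (t - 2) + kappa0 R * (t - 2) ^+ 2 / 2
  else phi t.

Definition design (R : realType) n (e : edge n) : 'cV[R]_n :=
  delta_mx (val e).1 0 - delta_mx (val e).2 0.

Definition lossbar (R : realType) n (g : graph n) (y : outcomes g)
    (theta : 'cV[R]_n) : R :=
  \sum_(e : {e | e \in g})
    (- ((y e)%:R * dot (design R (val e)) theta)
     + phibar (dot (design R (val e)) theta)).

Definition laplacian (R : realType) n (g : graph n) : 'M[R]_n :=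
  \sum_(e in g) design R e *m (design R e)^T.

Definition centering (R : realType) n : 'M[R]_n :=
  1%:M - n%:R^-1 *: (ones R n *m (ones R n)^T).

Definition laplace_pdf (R : realType) (eps w : R) : R :=
  eps / 4 * expR (- (eps * `|w| / 2)).

(* The estimator as a function of the value w of the noise vector W. *)
Definition estimator (R : realType) n (p : R) (g : graph n) (y : outcomes g)
    (w : 'cV[R]_n) : 'cV[R]_n :=
  if lambda2 (laplacian R g) < expR (- 1) * n%:R * p then 0
  else proj_onto (@Theta R n)
         (argmin_over (@orth1 R n)
            (fun theta => lossbar y theta + dot (centering R n *m w) theta)).

Definition btl_mechanism (R : realType) n (d : measure_display)
    (Om : measurableType d) (p : R) (W : 'I_n -> Om -> R) : mechanism R n Om :=
  fun g y w => estimator p y (\col_i W i w).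

(* Main.v *)
Require Import Defs.
From mathcomp Require Import all_boot all_order all_algebra.
From mathcomp Require Import all_classical all_reals all_analysis.
From mathcomp Require Import measurable_realfun perm ring lra.
From mathcomp.real_closed Require complex.
Import Order.TTheory GRing.Theory Num.Theory.
Import numFieldNormedType.Exports.
Set Implicit Arguments.
Unset Strict Implicit.
Unset Printing Implicit Defensive.
Local Open Scope classical_set_scope.
Local Open Scope ring_scope.

(** Privacy.  On the hyperplane orthogonal to the constants, flipping the outcome
    of the comparison e changes the objective by the linear form
    +-<x_e, theta>, which is exactly what translating the noise W by +-x_e does
    (estimator_shift).  So the claim reduces to the law of W: a translation by
    x_e = e_i - e_j moves two coordinates by one unit each, and each of these
    moves costs a factor e^{eps/2} because W_i has density proportional to
    e^{-eps|w|/2} (laplace_shift, design_shift_le).  This needs the estimator to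
    be Borel: it is continuous, because the minimizer of a strongly convex
    function is a Lipschitz function of a linear tilt (argmin_lipschitz).

    Risk.  Let mu = kappa0 lambda2(L_G).  The extension phibar of phi is
    kappa0-strongly convex on the whole line (phibar_strong_convex), so the
    loss is mu-strongly convex on the hyperplane, and comparing the minimizer
    with theta gives |thetatilde - theta| <= (2/mu) |grad(theta) + W|
    (argmin_dist); projecting on Theta costs a further constant.  For theta in
    Theta all the numbers <x_e, theta> lie in [-2, 2], where phibar' is the
    logistic function; hence the gradient is a sum of independent centred
    terms, and its mean square is at most the number of edges, of order n^2 p on
    average.  The noise contributes O(n/eps^2).  On graphs with
    lambda2 >= np/e this yields (n^2 p + n/eps^2)/(np)^2 = 1/p + 1/(n p^2 eps^2)
    up to a constant; on the other graphs, and in the regime where n is the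
    smaller term of the minimum, the diameter bound 4n is used.

    Connectivity.  It remains to see that lambda2 < np/e has probability at most
    1/n (lambda2_small_prob).  Put F(M) = tr M^{-q} with q of order log n.  The
    average of F(K I + p' J + L_G), J being the all-ones matrix, is bounded by
    replacing the random edges, one at a time, by deterministic edges of weight
    p' slightly smaller than p (potential_step, potential_mean_le).  When all
    edges are replaced the matrix is the multiple K + np' of the identity, so
    the average is at most n (K + np')^{-q}; a graph with lambda2 < t has F at
    least (K + t)^{-q}, and Markov's inequality gives
    n ((K + t)/(K + np'))^q, which is at most 1/n for t = np/e, K = np/20 and
    p' = 19p/20.  One replacement step follows from the convexity of F (Klein's
    inequality, potential_tangent) and from a comparison of M^{-q-1} with (M + xx^T)^{-q-1} in the direction x
    (resolvent_moment_le). *)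

(** * Spectral theorem for real symmetric matrices *)
Section SymmetricEigenvector.
Import complex.

(** Over the algebraically closed field R[i] there is an eigenvalue b with row
    eigenvector v; transposing and conjugating v A v^* = b v v^* shows that b
    is real, and a real eigenvalue has a real eigenvector. *)
Lemma symmetric_eigenvector (R : rcfType) n (A : 'M[R]_n.+1) :
  A^T = A -> exists a (v : 'rV_n.+1), v != 0 /\ v *m A = a *: v.
Proof.
move=> symA; pose f := real_complex R.
pose B := map_mx f A.
have [b eb] := eigenvalue_closed B isT.
have /eigenvalueP[v vB vN0] := eb.
pose ct m k (M : 'M[complex R]_(m, k)) := map_mx (@Num.conj _) (trmx M).
have ctM m k l (M : 'M[complex R]_(m, k)) (N : 'M[complex R]_(k, l)) :
    ct _ _ (M *m N) = ct _ _ N *m ct _ _ M.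
  by rewrite /ct trmx_mul map_mxM.
have ctK m k (M : 'M[complex R]_(m, k)) : ct _ _ (ct _ _ M) = M.
  by apply/matrixP => i j; rewrite !mxE conjCK.
have ctB : ct _ _ B = B.
  apply/matrixP => i j; rewrite !mxE -{1}symA mxE.
  by congr (_ +i* _)%C; rewrite oppr0.
have w0 : (v *m ct _ _ v) 0 0 != 0.
  apply: contraNneq vN0 => h; apply/eqP/rowP => i; rewrite mxE.
  move: h; rewrite mxE => /eqP; rewrite psumr_eq0.
    by move=> /allP /(_ i); rewrite mem_index_enum !mxE -normCK sqrf_eq0 normr_eq0 => /(_ isT)/eqP.
  by move=> j _; rewrite !mxE -normCK exprn_ge0.
have breal : b \is Num.real.
  apply/CrealP; apply: (mulIf w0).
  have h : v *m B *m ct _ _ v = b *: (v *m ct _ _ v) by rewrite vB scalemxAl.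
  have := congr1 (@ct _ _) h; rewrite !ctM ctK ctB mulmxA h => /matrixP/(_ 0 0).
  rewrite !mxE => ->; rewrite rmorphM; congr (_ * _).
  rewrite rmorph_sum; apply: eq_bigr => j _; rewrite !mxE rmorphM /= conjCK; exact: mulrC.
have [r br] : exists r, b = f r.
  by exists (complex.Re b); exact: (esym (RRe_real breal)).
have : eigenvalue A r.
  move: eb; rewrite !eigenvalue_root_char -map_char_poly br.
  by rewrite fmorph_root.
by move=> /eigenvalueP[u uA u0]; exists r, u.
Qed.
End SymmetricEigenvector.

(** If v <> e_0, the reflection in the hyperplane orthogonal to u = v - e_0
    exchanges the unit vectors e_0 and v. *)
Lemma householder (R : rcfType) n (v : 'rV[R]_(1 + n)) : v *m v^T = 1%:M ->
  exists H : 'M[R]_(1 + n), H^T *m H = 1%:M /\ delta_mx 0 0 *m H = v.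
Proof.
move=> v1; pose e : 'rV[R]_(1 + n) := delta_mx 0 0; pose u := v - e.
have e1 : e *m e^T = 1%:M by rewrite trmx_delta mul_delta_mx; apply/matrixP => i j; rewrite !ord1 !mxE.
pose c := (e *m v^T) 0 0.
have evc : e *m v^T = c%:M by apply/matrixP => i j; rewrite !ord1 [RHS]mxE.
have vec : v *m e^T = c%:M.
  by rewrite -[LHS]trmxK trmx_mul trmxK evc tr_scalar_mx.
have uu : u *m u^T = (2 - 2 * c)%:M.
  rewrite /u linearB /= mulmxBl !mulmxBr v1 e1 evc vec.
  apply/matrixP => i j; rewrite !ord1 !mxE eqxx /=; ring.
have [u0|u0] := eqVneq u 0.
  exists 1%:M; rewrite trmx1 !mulmx1; split=> //.
  by apply/eqP; rewrite eq_sym -subr_eq0 -/e -/u u0.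
have uN0 : 2 - 2 * c != 0.
  apply: contraNneq u0 => h; move: uu; rewrite h => /matrixP/(_ 0 0).
  rewrite !mxE /= mul0rn => /eqP; rewrite psumr_eq0; last first.
    by move=> i _; rewrite [in X in _ * X]mxE -expr2 sqr_ge0.
  move=> /allP h'; apply/eqP/rowP => i; have := h' i (mem_index_enum _).
  by rewrite [in X in _ * X]mxE -expr2 sqrf_eq0 [RHS]mxE /= => /eqP.
(* 2 - 2c = |u|^2, so that 1 - k u^T u is the reflection. *)
pose k := 2 / (2 - 2 * c).
have vE : v = e + u by rewrite /u addrC subrK.
have eu : e *m u^T = (c - 1)%:M.
  by rewrite /u linearB /= mulmxBr e1 evc raddfB.
clearbody u; have XX : u^T *m u *m (u^T *m u) = (2 - 2 * c) *: (u^T *m u).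
  by rewrite mulmxA -(mulmxA u^T) uu -mulmxA mul_scalar_mx -scalemxAr.
have eX : e *m (u^T *m u) = (c - 1) *: u by rewrite mulmxA eu mul_scalar_mx.
have trX : (u^T *m u)^T = u^T *m u by rewrite trmx_mul trmxK.
move: (u^T *m u) XX eX trX => X XX eX trX.
have trH : (1%:M - k *: X)^T = 1%:M - k *: X.
  by rewrite linearB /= trmx1 linearZ /= trX.
exists (1%:M - k *: X); split.
  rewrite trH.
  rewrite mulmxBl mul1mx mulmxBr mulmx1 -scalemxAl -scalemxAr XX !scalerA.
  apply/matrixP => i j; rewrite !mxE /k. field.
  by apply/eqP => h; case/negP: uN0; apply/eqP; lra.
rewrite -/e mulmxBr mulmx1 -scalemxAr eX scalerA vE; congr (_ + _).
have -> : k * (c - 1) = - 1.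
  by rewrite /k; field; apply/eqP => h; case/negP: uN0; apply/eqP; lra.
by rewrite scaleN1r opprK.
Qed.

(** Induction on the size: rotating a unit eigenvector to the first basis vector
    makes the matrix block diagonal, with a symmetric block of smaller size. *)
Lemma real_spectral (R : rcfType) n (A : 'M[R]_n) : A^T = A ->
  exists (U : 'M[R]_n) (d : 'rV[R]_n),
    U^T *m U = 1%:M /\ A = U^T *m diag_mx d *m U.
Proof.
elim: n A => [|n IH] A symA.
  by exists 1%:M, 0; split; apply/matrixP => -[].
have [a [w [w0 wA]]] := symmetric_eigenvector symA.
pose q := (w *m w^T) 0 0.
have q0 : 0 < q.
  rewrite lt0r /q mxE; apply/andP; split; last first.
    by apply: sumr_ge0 => i _; rewrite mxE -expr2 sqr_ge0.
  apply: contraNneq w0 => /eqP; rewrite psumr_eq0; last first.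
    by move=> i _; rewrite mxE -expr2 sqr_ge0.
  move=> /allP h; apply/eqP/rowP => i; have := h i (mem_index_enum _).
  by rewrite mxE -expr2 sqrf_eq0 [RHS]mxE /= => /eqP.
pose v := (Num.sqrt q)^-1 *: w.
have v1 : v *m v^T = 1%:M.
  rewrite /v linearZ /= -scalemxAl -scalemxAr scalerA -invfM -expr2.
  rewrite sqr_sqrtr ?ltW//; apply/matrixP => i j.
  by rewrite !ord1 [LHS]mxE -/q mulVf ?gt_eqF// mxE.
have vA : v *m A = a *: v by rewrite -scalemxAl wA !scalerA mulrC.
have [H [HH eH]] := @householder R n v v1.
have HH' : H *m H^T = 1%:M by exact: mulmx1C.
have [A' defA'] : exists A' : 'M[R]_(1 + n), A' = H *m A *m H^T by eexists.
have symA' : A'^T = A' by rewrite defA' !trmx_mul trmxK symA mulmxA.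
have row0 : delta_mx 0 0 *m A' = a *: delta_mx 0 0 :> 'rV[R]_(1 + n).
  by rewrite defA' !mulmxA eH vA -scalemxAl -eH -mulmxA HH' mulmx1.
have e0j j : A' 0 j = a * (j == 0)%:R.
  have := congr1 (fun M : 'rV[R]_(1 + n) => M 0 j) row0.
  by rewrite -rowE !mxE eqxx.
have l0 : lshift n (0 : 'I_1) = 0 by apply/val_inj.
have A'E : A' = block_mx a%:M 0 0 (drsubmx A').
  rewrite -[A' in LHS]submxK; congr block_mx.
  - by apply/matrixP => i j; rewrite !ord1 !mxE l0 e0j !eqxx mulr1.
  - by apply/matrixP => i j; rewrite !ord1 !mxE l0 e0j -val_eqE /= mulr0.
  - apply/matrixP => i j; rewrite -symA' !ord1 !mxE l0 e0j.
    by rewrite -val_eqE /= mulr0.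
have [|U [d [UU dE]]] := IH (drsubmx A').
  by rewrite -{2}symA' trmx_drsub.
have BB : (block_mx 1%:M 0 0 U : 'M[R]_(1 + n))^T *m block_mx 1%:M 0 0 U = 1%:M.
  rewrite tr_block_mx !trmx0 trmx1 mulmx_block.
  by rewrite !mul0mx !mulmx0 !addr0 !add0r mulmx1 UU -scalar_mx_block.
have BA : A' = (block_mx 1%:M 0 0 U : 'M[R]_(1 + n))^T
    *m diag_mx (row_mx a%:M d) *m block_mx 1%:M 0 0 U.
  rewrite [LHS]A'E dE diag_mx_row tr_block_mx !trmx0 trmx1 !mulmx_block.
  rewrite !mul0mx !mulmx0 !addr0 !add0r !mul1mx !mulmx1 mul0mx.
  by congr block_mx; apply/matrixP => i j; rewrite !ord1 !mxE.
move: (block_mx 1%:M 0 0 U) (row_mx a%:M d) BB BA => B D BB BA.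
exists (B *m H), D; rewrite trmx_mul; split.
  by rewrite mulmxA -(mulmxA H^T) BB mulmx1.
transitivity (H^T *m A' *m H).
  by rewrite defA' !mulmxA HH mul1mx -mulmxA HH mulmx1.
by rewrite BA !mulmxA.
Qed.

(** * Inner product and the second smallest eigenvalue *)
Section Dot.
Context (R : realType).
Implicit Types n : nat.

Lemma dotE n (u v : 'cV[R]_n) : dot u v = \sum_i u i 0 * v i 0.
Proof. by rewrite /dot mxE; apply: eq_bigr => i _; rewrite mxE. Qed.

Lemma dotC n (u v : 'cV[R]_n) : dot u v = dot v u.
Proof. by rewrite !dotE; apply: eq_bigr => i _; rewrite mulrC. Qed.

Lemma dotDr n (u v w : 'cV[R]_n) : dot u (v + w) = dot u v + dot u w.
Proof. by rewrite /dot mulmxDr mxE. Qed.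

Lemma dotDl n (u v w : 'cV[R]_n) : dot (v + w) u = dot v u + dot w u.
Proof. by rewrite dotC dotDr !(dotC u). Qed.

Lemma dotZr n a (u v : 'cV[R]_n) : dot u (a *: v) = a * dot u v.
Proof. by rewrite /dot -scalemxAr mxE. Qed.

Lemma dotZl n a (u v : 'cV[R]_n) : dot (a *: u) v = a * dot u v.
Proof. by rewrite dotC dotZr dotC. Qed.

Lemma dotNr n (u v : 'cV[R]_n) : dot u (- v) = - dot u v.
Proof. by rewrite -scaleN1r dotZr mulN1r. Qed.

Lemma dotNl n (u v : 'cV[R]_n) : dot (- u) v = - dot u v.
Proof. by rewrite dotC dotNr dotC. Qed.

Lemma dotBr n (u v w : 'cV[R]_n) : dot u (v - w) = dot u v - dot u w.
Proof. by rewrite dotDr dotNr. Qed.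

Lemma dotBl n (u v w : 'cV[R]_n) : dot (v - w) u = dot v u - dot w u.
Proof. by rewrite dotDl dotNl. Qed.

Lemma dot0r n (u : 'cV[R]_n) : dot u 0 = 0.
Proof. by rewrite /dot mulmx0 mxE. Qed.

Lemma dot_sumr n I (r : seq I) (P : pred I) (u : 'cV[R]_n) F :
  dot u (\sum_(i <- r | P i) F i) = \sum_(i <- r | P i) dot u (F i).
Proof.
by apply: (big_morph (dot u)); [move=> x y; exact: dotDr | exact: dot0r].
Qed.

Lemma dot_suml n I (r : seq I) (P : pred I) (u : 'cV[R]_n) F :
  dot (\sum_(i <- r | P i) F i) u = \sum_(i <- r | P i) dot (F i) u.
Proof. by rewrite dotC dot_sumr; apply: eq_bigr => i _; rewrite dotC. Qed.

Lemma dot_mulmx n (A : 'M[R]_n) (u v : 'cV[R]_n) :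
  dot (A *m u) v = dot u (A^T *m v).
Proof. by rewrite /dot trmx_mul mulmxA. Qed.

Lemma dot_mulmx_rank1 n (x u v : 'cV[R]_n) :
  dot u (x *m x^T *m v) = dot u x * dot x v.
Proof.
rewrite /dot -!mulmxA mulmxA [in LHS](mx11_scalar (x^T *m v)) mul_mx_scalar.
by rewrite [LHS]mxE mulrC.
Qed.

Lemma sqnorm2E n (u : 'cV[R]_n) : sqnorm2 u = \sum_i u i 0 ^+ 2.
Proof. by rewrite /sqnorm2 dotE; apply: eq_bigr => i _; rewrite expr2. Qed.

Lemma sqnorm2_ge0 n (u : 'cV[R]_n) : 0 <= sqnorm2 u.
Proof. by rewrite sqnorm2E; apply: sumr_ge0 => i _; exact: sqr_ge0. Qed.

Lemma sqnorm2_eq0 n (u : 'cV[R]_n) : (sqnorm2 u == 0) = (u == 0).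
Proof.
apply/idP/eqP => [|->]; last by rewrite /sqnorm2 dot0r.
rewrite sqnorm2E psumr_eq0 => [/allP h|i _]; last exact: sqr_ge0.
apply/colP => i; have := h i (mem_index_enum _).
by rewrite sqrf_eq0 mxE => /eqP.
Qed.

Lemma sqnorm2D_le n (u v : 'cV[R]_n) :
  sqnorm2 (u + v) <= 2 * sqnorm2 u + 2 * sqnorm2 v.
Proof.
have := sqnorm2_ge0 (u - v).
rewrite /sqnorm2 !(dotDl, dotDr, dotNl, dotNr) (dotC v u); lra.
Qed.

Lemma sqnorm2N n (u : 'cV[R]_n) : sqnorm2 (- u) = sqnorm2 u.
Proof. by rewrite /sqnorm2 dotNl dotNr opprK. Qed.

Lemma sqnorm2Z n a (u : 'cV[R]_n) : sqnorm2 (a *: u) = a ^+ 2 * sqnorm2 u.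
Proof. by rewrite /sqnorm2 dotZl dotZr mulrA expr2. Qed.

Lemma dot_delta n (i : 'I_n) (u : 'cV[R]_n) : dot (delta_mx i 0) u = u i 0.
Proof.
rewrite dotE (bigD1 i) //= mxE !eqxx mul1r big1 ?addr0// => j ji.
by rewrite mxE (negbTE ji) mul0r.
Qed.

Section SpectralForm.
Context n (U : 'M[R]_n) (UU : U^T *m U = 1%:M).

Lemma dot_orth (u v : 'cV[R]_n) : dot (U *m u) (U *m v) = dot u v.
Proof. by rewrite dot_mulmx mulmxA UU mul1mx. Qed.

Lemma orthT (x : 'cV[R]_n) : U *m (U^T *m x) = x.
Proof. by rewrite mulmxA (mulmx1C UU) mul1mx. Qed.

Lemma dot_diag (d : 'rV[R]_n) (u v : 'cV[R]_n) :
  dot u (U^T *m diag_mx d *m U *m v) =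
  \sum_k d 0 k * (U *m u) k 0 * (U *m v) k 0.
Proof.
rewrite -!mulmxA -[U^T in LHS]/(U^T) -dot_mulmx dotE; apply: eq_bigr => k _.
by rewrite mul_diag_mx [X in _ * X]mxE mulrCA mulrA.
Qed.
End SpectralForm.

(** The characteristic polynomial determines the sorted list of its roots, so
    the choice made in the definition of the spectrum is harmless. *)
Lemma spectrum_diag n (U : 'M[R]_n) (d : 'rV[R]_n) : U^T *m U = 1%:M ->
  spectrum (U^T *m diag_mx d *m U) = sort <=%R [seq d 0 k | k <- enum 'I_n].
Proof.
move=> UU; have UU' := mulmx1C UU.
have cp : char_poly (U^T *m diag_mx d *m U) = \prod_k ('X - (d 0 k)%:P).
  transitivity (char_poly (diag_mx d)); last first.
    rewrite char_poly_trig ?diag_mx_is_trig//.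
    by apply: eq_bigr => k _; rewrite mxE eqxx.
  rewrite /char_poly.
  have -> : char_poly_mx (U^T *m diag_mx d *m U) =
      map_mx polyC U^T *m char_poly_mx (diag_mx d) *m map_mx polyC U.
    rewrite /char_poly_mx mulmxBr mulmxBl -!map_mxM; congr (_ - _).
    by rewrite mul_mx_scalar -scalemxAl -map_mxM UU map_mx1 scalemx1.
  rewrite !det_mulmx mulrAC -det_mulmx -map_mxM UU map_mx1 det1 mul1r//.
rewrite /spectrum; case: xgetP => [s -> [ss cs]|h].
  apply: (sorted_eq le_trans le_anti) => //.
    exact/sort_sorted/le_total.
  rewrite perm_sym perm_sort perm_sym; apply: prod_XsubC_eq.
  by rewrite -cs cp big_map big_enum.
case: (h (sort <=%R [seq d 0 k | k <- enum 'I_n])); split.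
  exact/sort_sorted/le_total.
rewrite cp (perm_big [seq d 0 k | k <- enum 'I_n]) ?big_map ?big_enum//.
by rewrite perm_sort.
Qed.

(** The index i is that of a smallest eigenvalue, j that of the second one. *)
Lemma lambda2_indices m (U : 'M[R]_m.+2) (d : 'rV[R]_m.+2) (A : 'M[R]_m.+2) :
  U^T *m U = 1%:M -> A = U^T *m diag_mx d *m U ->
  exists i j, [/\ i != j, d 0 i <= lambda2 A, d 0 j = lambda2 A &
    forall k, k != i -> lambda2 A <= d 0 k].
Proof.
move=> UU ->; rewrite /lambda2 spectrum_diag//.
set t := [tuple d 0 k | k < m.+2].
have tE : [seq d 0 k | k <- enum 'I_m.+2] = t by [].
have /tuple_permP[p pE] : perm_eq (sort <=%R t) t by rewrite perm_sort.
have st : sorted <=%R (sort <=%R t) by exact/sort_sorted/le_total.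
have sk (k : 'I_m.+2) : (sort <=%R t)`_k = d 0 (p k).
  rewrite pE -[X in X`_k]/(tval [tuple tnth t (p i) | i < m.+2]).
  by rewrite -tnth_nth !tnth_mktuple.
have ss : size (sort <=%R t) = m.+2 by rewrite size_sort size_tuple.
rewrite tE; have j1 : (1 < m.+2)%N by [].
have := sk (Ordinal j1); rewrite /= => s1.
exists (p ord0), (p (Ordinal j1)); split.
- by rewrite (inj_eq perm_inj).
- rewrite -sk; apply: (sorted_leq_nth le_trans lexx _ st) => //.
  + by rewrite inE ss.
  + by rewrite inE ss.
- by [].
move=> k; rewrite -(permKV p k) (inj_eq perm_inj) -sk => k0.
apply: (sorted_leq_nth le_trans lexx _ st) => //.
- by rewrite inE ss.
- by rewrite inE ss.
by rewrite lt0n -(inj_eq val_inj) in k0 *.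
Qed.

(** Courant-Fischer when the kernel vector e is known.  If lambda2 A > 0 then
    all eigenvectors but one have positive eigenvalue, hence are orthogonal to
    e; so e spans the remaining line, x has no component along it, and only
    eigenvalues at least lambda2 A contribute. *)
Lemma lambda2_form_le m (A : 'M[R]_m.+2) (e x : 'cV[R]_m.+2) :
  A^T = A -> (forall v, 0 <= dot v (A *m v)) -> A *m e = 0 ->
  e != 0 -> dot e x = 0 -> lambda2 A * sqnorm2 x <= dot x (A *m x).
Proof.
move=> symA psdA Ae e0 ex.
have [U [d [UU AE]]] := real_spectral symA.
have [i [j [ij di dj dk]]] := lambda2_indices UU AE.
have [l0|l0] := leP (lambda2 A) 0.
  by apply: le_trans (psdA _); rewrite mulr_le0_ge0 ?sqnorm2_ge0.
have Uek k : k != i -> (U *m e) k 0 = 0.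
  move=> /dk lk; have dk0 : d 0 k != 0 by rewrite gt_eqF// (lt_le_trans l0).
  have : (U *m (A *m e)) k 0 = 0 by rewrite Ae mulmx0 mxE.
  rewrite AE -!mulmxA orthT// mul_diag_mx mxE => /eqP.
  by rewrite mulf_eq0 (negbTE dk0) => /eqP.
have Uxi : (U *m x) i 0 = 0.
  move: ex; rewrite -(dot_orth UU) dotE (bigD1 i)//= big1 ?addr0; last first.
    by move=> k ki; rewrite Uek// mul0r.
  move/eqP; rewrite mulf_eq0 => /orP[/eqP ei|/eqP//].
  case/eqP: e0; apply/eqP; rewrite -sqnorm2_eq0 /sqnorm2 -(dot_orth UU) dotE.
  rewrite big1// => k _; have [->|ki] := eqVneq k i; first by rewrite ei mul0r.
  by rewrite Uek// mul0r.
rewrite [X in dot _ (X *m _)]AE dot_diag// /sqnorm2 -(dot_orth UU) dotE mulr_sumr.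
apply: ler_sum => k _; rewrite -[leRHS]mulrA -!expr2.
have [->|ki] := eqVneq k i; first by rewrite Uxi expr0n !mulr0.
by rewrite ler_wpM2r ?sqr_ge0// dk.
Qed.

(** Two eigenvectors with eigenvalues at most lambda2 A span a plane, which
    contains a nonzero vector orthogonal to e. *)
Lemma lambda2_witness m (A : 'M[R]_m.+2) (e : 'cV[R]_m.+2) : A^T = A ->
  exists v, [/\ v != 0, dot e v = 0 & dot v (A *m v) <= lambda2 A * sqnorm2 v].
Proof.
move=> symA.
have [U [d [UU AE]]] := real_spectral symA.
have [i [j [ij di dj dk]]] := lambda2_indices UU AE.
have [a [b [ab eab]]] : exists a b : R, (a != 0) || (b != 0) /\
    a * (U *m e) i 0 + b * (U *m e) j 0 = 0.
  have [h|h] := eqVneq ((U *m e) i 0) 0.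
    by exists 1, 0; rewrite oner_eq0 h mulr0 mul0r addr0.
  exists ((U *m e) j 0), (- (U *m e) i 0); rewrite oppr_eq0 h orbT; split=> //.
  ring.
pose y : 'cV[R]_m.+2 := a *: delta_mx i 0 + b *: delta_mx j 0.
have yi : y i 0 = a by rewrite !mxE !eqxx (negbTE ij) mulr1 mulr0 addr0.
have yj : y j 0 = b by rewrite !mxE !eqxx eq_sym (negbTE ij) mulr1 mulr0 add0r.
have yk k : k != i -> k != j -> y k 0 = 0.
  by move=> /negbTE ki /negbTE kj; rewrite !mxE ki kj !mulr0 addr0.
exists (U^T *m y); split.
- apply: contraTneq ab => h; have : U *m (U^T *m y) = 0 by rewrite h mulmx0.
  rewrite orthT// => y0; move: yi yj; rewrite y0 !mxE => <- <-.
  by rewrite eqxx.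
- rewrite -(dot_orth UU) orthT// dotDr !dotZr !(dotC _ (delta_mx _ _)).
  by rewrite !dot_delta.
rewrite [X in dot _ (X *m _)]AE dot_diag// /sqnorm2 -(dot_orth UU) !orthT//.
rewrite dotE mulr_sumr; apply: ler_sum => k _; rewrite -mulrA -!expr2.
have [->|ki] := eqVneq k i; first by rewrite ler_wpM2r ?sqr_ge0.
have [->|kj] := eqVneq k j; first by rewrite dj.
by rewrite yk// expr0n !mulr0.
Qed.

End Dot.

(** * Scalar inequalities *)
Section Scalar.
Context (R : realType).
Implicit Types (x y a b : R).

Lemma bernoulli_ineq q y : 0 <= y -> 1 + q%:R * (y - 1) <= y ^+ q.
Proof.
move=> y0; elim: q => [|q IH]; first by rewrite mul0r addr0 expr0.
rewrite exprS; apply: (@le_trans _ _ (y * (1 + q%:R * (y - 1)))); last first.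
  by rewrite ler_wpM2l.
rewrite -natr1; have : 0 <= q%:R * (y - 1) ^+ 2 by rewrite mulr_ge0 ?sqr_ge0.
rewrite expr2; lra.
Qed.

(** The convex function t |-> t^{-q} lies above its tangent line at b. *)
Lemma invpow_tangent q a b : 0 < a -> 0 < b ->
  b^-1 ^+ q - q%:R * b^-1 ^+ q.+1 * (a - b) <= a^-1 ^+ q.
Proof.
move=> a0 b0; have ba0 : 0 <= b / a by rewrite divr_ge0 ?ltW.
have h := bernoulli_ineq q ba0.
have -> : a^-1 ^+ q = b^-1 ^+ q * (b / a) ^+ q.
  by rewrite -exprMn; congr (_ ^+ _); field; rewrite !gt_eqF.
have bq : 0 <= b^-1 ^+ q by rewrite exprn_ge0 ?invr_ge0 ?ltW.
apply: le_trans (ler_wpM2l bq h).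
rewrite exprS.
have -> : b^-1 ^+ q - q%:R * (b^-1 * b^-1 ^+ q) * (a - b) =
   b^-1 ^+ q * (1 - q%:R * (a / b - 1)) by field; rewrite gt_eqF.
apply: ler_wpM2l => //.
rewrite -subr_ge0.
have -> : 1 + q%:R * (b / a - 1) - (1 - q%:R * (a / b - 1)) =
  q%:R * ((a - b) ^+ 2 / (a * b)) by field; rewrite !gt_eqF.
by rewrite mulr_ge0// divr_ge0 ?sqr_ge0// mulr_ge0 ?ltW.
Qed.

(** Chebyshev's sum inequality: after symmetrizing in (k, l), the difference of
    the two sides is a sum of terms in which u_k^i - u_l^i and u_k^j - u_l^j
    have the same sign. *)
Lemma moment_ineq n (w u : 'I_n -> R) i j :
  (forall k, 0 <= w k) -> (forall k, 0 <= u k) ->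
  (\sum_k w k * u k ^+ i.+1) * (\sum_k w k * u k ^+ j.+1) <=
  (\sum_k w k * u k) * (\sum_k w k * u k ^+ (i + j).+1).
Proof.
move=> w0 u0; pose f k l := w k * w l *
  (u k * u l ^+ (i + j).+1 - u k ^+ i.+1 * u l ^+ j.+1).
have -> (a b : R) : a <= b = (0 <= b - a) by rewrite subr_ge0.
have -> : (\sum_k w k * u k) * (\sum_k w k * u k ^+ (i + j).+1) -
  (\sum_k w k * u k ^+ i.+1) * (\sum_k w k * u k ^+ j.+1) =
  \sum_k \sum_l f k l.
  rewrite !mulr_suml -sumrB; apply: eq_bigr => k _.
  rewrite !mulr_sumr -sumrB; apply: eq_bigr => l _; rewrite /f; ring.
rewrite -(@pmulr_rge0 _ 2)// mulr_natl mulr2n.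
rewrite {2}exchange_big -big_split /=; apply: sumr_ge0 => k _.
rewrite -big_split /=; apply: sumr_ge0 => l _.
have -> : f k l + f l k =
    w k * w l * (u k * u l) * ((u k ^+ i - u l ^+ i) * (u k ^+ j - u l ^+ j)).
  rewrite /f !exprS !exprD; ring.
apply: mulr_ge0; first by rewrite !mulr_ge0.
have [kl|lk] := leP (u k) (u l).
  by rewrite mulr_le0// subr_le0 lerXn2r ?nnegrE.
by rewrite mulr_ge0// subr_ge0 lerXn2r ?nnegrE// ltW.
Qed.
End Scalar.

(** * The potential tr M^{-q} *)
Section Potential.
Context (R : realType) (m : nat).
Implicit Types (M N A B : 'M[R]_m.+1) (x : 'cV[R]_m.+1) (K p : R).

(** The Loewner order M >= K I. *)
Definition sym_ge K M :=
  M^T = M /\ forall x, K * sqnorm2 x <= dot x (M *m x).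

(** A smooth substitute for the smallest eigenvalue: up to the dimension it is
    the -q-th power of that eigenvalue. *)
Definition potential q M := \tr (invmx M ^+ q).

(** The function f of a symmetric matrix with orthonormal eigenvectors the rows
    of U, f being given by its values at the indices of the eigenvalues. *)
Definition spectral_fun (U : 'M[R]_m.+1) (f : 'I_m.+1 -> R) :=
  U^T *m diag_mx (\row_k f k) *m U.

Lemma spectral_funM (U : 'M[R]_m.+1) f g : U^T *m U = 1%:M ->
  spectral_fun U f *m spectral_fun U g = spectral_fun U (fun k => f k * g k).
Proof.
move=> UU; rewrite /spectral_fun -!mulmxA (mulmxA U) (mulmx1C UU) mul1mx.
rewrite (mulmxA (diag_mx _)) mulmx_diag; congr (_ *m (_ *m _)); congr diag_mx.
by apply/rowP => k; rewrite !mxE.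
Qed.

Lemma spectral_fun1 (U : 'M[R]_m.+1) : U^T *m U = 1%:M ->
  spectral_fun U (fun=> 1) = 1%:M.
Proof.
move=> UU; rewrite /spectral_fun.
have -> : \row_(k < m.+1) 1 = const_mx 1 :> 'rV[R]_m.+1.
  by apply/rowP => k; rewrite !mxE.
by rewrite diag_const_mx mulmx1.
Qed.

Lemma spectral_funX (U : 'M[R]_m.+1) f q : U^T *m U = 1%:M ->
  spectral_fun U f ^+ q = spectral_fun U (fun k => f k ^+ q).
Proof.
move=> UU; elim: q => [|q IH]; first by rewrite expr0 spectral_fun1.
rewrite exprS IH -[_ * _]/(_ *m _) spectral_funM//.
by congr spectral_fun; apply/funext => k; rewrite exprS.
Qed.

Lemma dot_spectral_fun (U : 'M[R]_m.+1) f x y : U^T *m U = 1%:M ->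
  dot x (spectral_fun U f *m y) = \sum_k f k * (U *m x) k 0 * (U *m y) k 0.
Proof. by move=> UU; rewrite dot_diag//; apply: eq_bigr => k _; rewrite mxE. Qed.

(** The weights (V U^T)_{lk}^2 turn the trace of a product of two functions of
    non-commuting matrices into a positive combination of scalar products; any
    scalar inequality in two variables thus becomes a trace inequality. *)
Lemma trace_spectral_fun2 (U V : 'M[R]_m.+1) f g :
  U^T *m U = 1%:M -> V^T *m V = 1%:M ->
  \tr (spectral_fun V f *m spectral_fun U g) =
  \sum_l \sum_k f l * g k * (V *m U^T) l k ^+ 2.
Proof.
move=> UU VV; transitivity
    (\tr (diag_mx (\row_l f l) *m ((V *m U^T) *m diag_mx (\row_k g k) *m (V *m U^T)^T))).
  rewrite /spectral_fun -!mulmxA mxtrace_mulC trmx_mul trmxK.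
  by rewrite !mulmxA.
rewrite /mxtrace; apply: eq_bigr => l _; rewrite mul_diag_mx mxE [X in X * _]mxE.
rewrite [X in _ * X]mxE mulr_sumr; apply: eq_bigr => k _.
rewrite mul_mx_diag; move: (V *m U^T) => O.
by rewrite !mxE; ring.
Qed.

Lemma sym_geD K M N : sym_ge K M -> sym_ge 0 N -> sym_ge K (M + N).
Proof.
move=> [sM hM] [sN hN]; split; first by rewrite linearD /= sM sN.
move=> x; rewrite mulmxDl dotDr; have := hM x; have := hN x; lra.
Qed.

Lemma sym_ge_rank1 c x : 0 <= c -> sym_ge 0 (c *: (x *m x^T)).
Proof.
move=> c0; split; first by rewrite linearZ /= trmx_mul trmxK.
move=> y; rewrite mul0r -scalemxAl dotZr dot_mulmx_rank1 (dotC x) -expr2.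
by rewrite mulr_ge0 ?sqr_ge0.
Qed.

Lemma sym_ge_spectral K M : 0 < K -> sym_ge K M ->
  exists U d, [/\ U^T *m U = 1%:M, M = spectral_fun U d, (forall k, K <= d k),
     invmx M = spectral_fun U (fun k => (d k)^-1) & M \in unitmx].
Proof.
move=> K0 [sM hM]; have [U [d [UU ME]]] := real_spectral sM.
have ME' : M = spectral_fun U (d 0).
  by rewrite ME /spectral_fun; congr (_ *m diag_mx _ *m _); apply/rowP => k; rewrite mxE.
have dK k : K <= d 0 k.
  have := hM (U^T *m delta_mx k 0).
  rewrite ME' dot_spectral_fun// orthT// /sqnorm2 -(dot_orth UU) orthT//.
  rewrite dot_delta mxE !eqxx mulr1 (bigD1 k)//= big1.
    by rewrite mxE !eqxx addr0 !mulr1.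
  by move=> l lk; rewrite mxE (negbTE lk) !mulr0.
have MV : M *m spectral_fun U (fun k => (d 0 k)^-1) = 1%:M.
  rewrite ME' spectral_funM// -(spectral_fun1 UU); congr spectral_fun.
  by apply/funext => k; rewrite mulfV// gt_eqF// (lt_le_trans K0).
have [uM _] := mulmx1_unit MV.
exists U, (d 0); split=> //.
by rewrite -[RHS](mulKmx uM) MV mulmx1.
Qed.

Lemma potential_spectral K M : 0 < K -> sym_ge K M ->
  exists U d, [/\ U^T *m U = 1%:M, M = spectral_fun U d, (forall k, K <= d k),
    (forall q, invmx M ^+ q = spectral_fun U (fun k => (d k)^-1 ^+ q)) &
    forall q, potential q M = \sum_k (d k)^-1 ^+ q].
Proof.
move=> K0 /(sym_ge_spectral K0)[U [d [UU ME dK iM uM]]].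
have MX q : invmx M ^+ q = spectral_fun U (fun k => (d k)^-1 ^+ q).
  by rewrite iM spectral_funX.
exists U, d; split=> // q; rewrite /potential MX /spectral_fun.
rewrite -mulmxA mxtrace_mulC -mulmxA (mulmx1C UU) mulmx1 mxtrace_diag.
by apply: eq_bigr => k _; rewrite mxE.
Qed.

(** Klein's inequality for t^{-q}: in eigenbases of A and B the claim is the
    average of invpow_tangent over the pairs of eigenvalues. *)
Lemma potential_tangent K q A B : 0 < K -> sym_ge K A -> sym_ge K B ->
  potential q B - q%:R * \tr (invmx B ^+ q.+1 *m (A - B)) <= potential q A.
Proof.
move=> K0 hA hB.
have [U [a [UU AE aK AX pA]]] := potential_spectral K0 hA.
have [V [b [VV BE bK BX pB]]] := potential_spectral K0 hB.
have trl M : M = spectral_fun V (fun=> 1) *m M by rewrite spectral_fun1// mul1mx.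
have trr M : M = M *m spectral_fun U (fun=> 1) by rewrite spectral_fun1// mulmx1.
rewrite /potential [invmx A ^+ q]trl [invmx B ^+ q]trr AX !BX mulmxBr.
have -> : spectral_fun V (fun k => (b k)^-1 ^+ q.+1) *m B =
    spectral_fun V (fun k => (b k)^-1 ^+ q.+1 * b k) *m spectral_fun U (fun=> 1).
  by rewrite -trr [in LHS]BE spectral_funM.
rewrite [in X in _ * X]AE raddfB /= !trace_spectral_fun2//.
rewrite -sumrB mulr_sumr -sumrB; apply: ler_sum => l _.
rewrite -sumrB mulr_sumr -sumrB; apply: ler_sum => k _.
have a0 : 0 < a k by exact: lt_le_trans (aK k).
have b0 : 0 < b l by exact: lt_le_trans (bK l).
have := ler_wpM2r (sqr_ge0 ((V *m U^T) l k)) (invpow_tangent q a0 b0).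
move: (_ ^+ 2) ((b l)^-1 ^+ q.+1) ((b l)^-1 ^+ q) ((a k)^-1 ^+ q) => w B1 B2 A1.
by clear; lra.
Qed.

Lemma tr_mulmx_rank1 A x : \tr (A *m (x *m x^T)) = dot x (A *m x).
Proof. by rewrite mulmxA mxtrace_mulC /dot trace_mx11. Qed.

Lemma inverse_form_le K M x : 0 < K -> sym_ge K M ->
  0 <= dot x (invmx M *m x) <= sqnorm2 x / K.
Proof.
move=> K0 hM; have [U [d [UU ME dK iM uM]]] := sym_ge_spectral K0 hM.
rewrite iM dot_spectral_fun// /sqnorm2 -(dot_orth UU) dotE mulr_suml.
apply/andP; split.
  apply: sumr_ge0 => k _; rewrite -mulrA mulr_ge0 ?invr_ge0 -?expr2 ?sqr_ge0//.
  by rewrite (le_trans (ltW K0)).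
apply: ler_sum => k _; rewrite -[leLHS]mulrA [leRHS]mulrC.
apply: ler_wpM2r; first by rewrite -expr2 sqr_ge0.
by rewrite lef_pV2 ?posrE// (lt_le_trans K0).
Qed.

(** Write R0 = M^{-1}, R1 = (M + x x^T)^{-1} and a = <x, R0 x>.  The
    Sherman-Morrison formula reads R0 = R1 + (1 + a) R1 x x^T R1.  Expanding one
    factor R0 at a time produces products of moments <x, R1^i x>, which
    moment_ineq merges into a single one; as (1 + a) <x, R1 x> = a, each
    expansion costs a factor 1 + a. *)
Lemma resolvent_moment_le K M x k : 0 < K -> sym_ge K M ->
  dot x (invmx M ^+ k *m x) <=
  (1 + dot x (invmx M *m x)) ^+ k * dot x (invmx (M + x *m x^T) ^+ k *m x).
Proof.
move=> K0 hM; set a := dot x (invmx M *m x).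
have hN : sym_ge K (M + x *m x^T).
  by apply: sym_geD => //; rewrite -[_ *m _]scale1r; exact: sym_ge_rank1.
have [_ [_ [_ _ _ _ uM]]] := sym_ge_spectral K0 hM.
have [V [d [VV NE dK iN uN]]] := sym_ge_spectral K0 hN.
have a0 : 0 <= a by have /andP[] := inverse_form_le x K0 hM.
pose N := M + x *m x^T; pose R0 := invmx M; pose R1 := invmx N.
have e1 : R0 = R1 + R1 *m (x *m x^T) *m R0.
  by rewrite -[LHS](mulKmx uN) -/R1 mulmxDl mulmxV// mulmxDr mulmx1 !mulmxA.
have e2 : R0 = R1 + R0 *m (x *m x^T) *m R1.
  by rewrite -[LHS](mulmxK uN) -/R1 mulmxDr mulVmx// mulmxDl mul1mx.
have Rx : R0 *m x = (1 + a) *: (R1 *m x).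
  rewrite {1}e1 mulmxDl scalerDl scale1r; congr (_ + _).
  rewrite -!mulmxA [x^T *m _]mx11_scalar mul_mx_scalar -scalemxAr.
  by rewrite /a /dot.
have R0E : R0 = R1 + (1 + a) *: (R1 *m (x *m x^T) *m R1).
  by rewrite {1}e2 !mulmxA Rx -!scalemxAl.
pose n_ k := dot x (R1 ^+ k *m x).
have nE j : n_ j = \sum_l (V *m x) l 0 ^+ 2 * (d l)^-1 ^+ j.
  rewrite /n_ /R1 iN spectral_funX// dot_spectral_fun//.
  by apply: eq_bigr => l _; rewrite -mulrA -expr2 mulrC.
have d0 l : 0 <= (d l)^-1 by rewrite invr_ge0 (le_trans (ltW K0)).
have n0 j : 0 <= n_ j.
  by rewrite nE; apply: sumr_ge0 => l _; rewrite mulr_ge0 ?sqr_ge0 ?exprn_ge0.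
have nmul i j : n_ i.+1 * n_ j.+1 <= n_ 1 * n_ (i + j).+1.
  rewrite !nE; under [X in _ <= X * _]eq_bigr do rewrite expr1.
  by apply: moment_ineq => // l; exact: sqr_ge0.
have ab : (1 + a) * n_ 1 = a by rewrite /n_ expr1 -dotZr -Rx.
(* Powers of R1 on both sides are what one expansion step leaves behind. *)
suff T i j : dot x ((R1 ^+ i *m R0 ^+ k *m R1 ^+ j) *m x) <=
    (1 + a) ^+ k * n_ (i + k + j)%N.
  by have := T 0%N 0%N; rewrite !expr0 mul1mx mulmx1 add0n addn0.
have a1 : 0 <= 1 + a by lra.
clear hM hN; elim: k i j => [|k IH] i j.
  rewrite expr0 mulmx1 addn0 expr0 mul1r /n_ exprD//.
rewrite exprSr {2}R0E.
have -> : R1 ^+ i *m (R0 ^+ k * (R1 + (1 + a) *: (R1 *m (x *m x^T) *m R1))) *m R1 ^+ j *m x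
  = R1 ^+ i *m R0 ^+ k *m R1 ^+ j.+1 *m x +
    ((1 + a) * n_ j.+1) *: (R1 ^+ i *m R0 ^+ k *m R1 ^+ 1 *m x).
  rewrite -[_ * _]/(_ *m _) mulmxDr mulmxDr !mulmxDl !exprS expr0 mulr1.
  rewrite -[R1 * R1 ^+ j]/(_ *m _) !mulmxA; congr (_ + _).
  rewrite -!scalemxAr -!scalemxAl -scalerA; congr (_ *: _).
  rewrite -!mulmxA; do 4![rewrite -?scalemxAr].
  rewrite [x^T *m _]mx11_scalar mul_mx_scalar -!scalemxAr /n_ /dot.
  by rewrite exprS -[R1 * R1 ^+ j]/(_ *m _) !mulmxA.
rewrite dotDr dotZr.
have n1 : n_ j.+1 * n_ (i + k).+1 <= n_ 1 * n_ (i + k.+1 + j)%N.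
  by rewrite (_ : (i + k.+1 + j) = (j + (i + k)).+1)%N ?nmul// addnS addSn addnC.
have h1 := IH i j.+1; have h2 := IH i 1%N.
rewrite (_ : (i + k + j.+1) = (i + k.+1 + j))%N in h1; last by rewrite !addnS addSn.
rewrite addn1 in h2.
apply: le_trans (lerD h1 (ler_wpM2l _ h2)) _; first by rewrite mulr_ge0.
rewrite exprSr -[leRHS]mulrA.
have -> : (1 + a) ^+ k * n_ (i + k.+1 + j)%N + (1 + a) * n_ j.+1 * ((1 + a) ^+ k * n_ (i + k).+1)
  = (1 + a) ^+ k * (n_ (i + k.+1 + j)%N + (1 + a) * (n_ j.+1 * n_ (i + k).+1)) by ring.
apply: ler_wpM2l; first by rewrite exprn_ge0.
apply: le_trans (lerD (lexx _) (ler_wpM2l a1 n1)) _.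
by rewrite mulrA ab mulrDl mul1r.
Qed.

(** Keeping the rank-one term with probability p is no worse for the mean
    potential than keeping it always with weight p'.  With N = M + x x^T, the
    tangent at N gives F(N) <= F(M) - q <x, N^{-q-1} x>, the tangent at M gives
    F(M + p' x x^T) >= F(M) - q p' <x, M^{-q-1} x>, and resolvent_moment_le
    compares the two correction terms. *)
Lemma potential_step K M x q p p' : 0 < K -> sym_ge K M -> 0 <= p -> 0 <= p' ->
  p' * (1 + sqnorm2 x / K) ^+ q.+1 <= p ->
  (1 - p) * potential q M + p * potential q (M + x *m x^T) <=
  potential q (M + p' *: (x *m x^T)).
Proof.
move=> K0 hM p0 p'0 pp'.
have hN : sym_ge K (M + x *m x^T).
  by apply: sym_geD => //; rewrite -[_ *m _]scale1r; exact: sym_ge_rank1.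
have hP : sym_ge K (M + p' *: (x *m x^T)).
  by apply: sym_geD => //; exact: sym_ge_rank1.
have t1 := potential_tangent q K0 hP hM.
have t2 := potential_tangent q K0 hM hN.
have e1 : \tr (invmx M ^+ q.+1 *m (M + p' *: (x *m x^T) - M)) =
    p' * dot x (invmx M ^+ q.+1 *m x).
  by rewrite addrAC subrr add0r -scalemxAr linearZ /= tr_mulmx_rank1.
have e2 : \tr (invmx (M + x *m x^T) ^+ q.+1 *m (M - (M + x *m x^T))) =
    - dot x (invmx (M + x *m x^T) ^+ q.+1 *m x).
  by rewrite opprD addrA subrr add0r mulmxN raddfN /= tr_mulmx_rank1.
have := resolvent_moment_le x q.+1 K0 hM.
have /andP[a0 aK] := inverse_form_le x K0 hM.
move: (dot x (invmx M *m x)) a0 aK => a a0 aK /=.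
have m0 : 0 <= dot x (invmx M ^+ q.+1 *m x).
  have [U [d [UU ME dK MX pM]]] := potential_spectral K0 hM.
  rewrite MX dot_spectral_fun//; apply: sumr_ge0 => k _.
  rewrite -mulrA mulr_ge0// -?expr2 ?sqr_ge0// exprn_ge0// invr_ge0.
  exact: le_trans (ltW K0) (dK k).
have l0 : 0 <= dot x (invmx (M + x *m x^T) ^+ q.+1 *m x).
  have [U [d [UU ME dK MX pM]]] := potential_spectral K0 hN.
  rewrite MX dot_spectral_fun//; apply: sumr_ge0 => k _.
  rewrite -mulrA mulr_ge0// -?expr2 ?sqr_ge0// exprn_ge0// invr_ge0.
  exact: le_trans (ltW K0) (dK k).
move: t1 t2; rewrite {}e1 {}e2.
move: (dot x (invmx M ^+ q.+1 *m x))
  (dot x (invmx (M + x *m x^T) ^+ q.+1 *m x)) m0 l0 => m0 m1 m0_ge0 m1_ge0.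
move: (potential q M) (potential q (M + x *m x^T))
  (potential q (M + p' *: _)).
move=> f0 f1 f' t1 t2 m01.
have h : p' * m0 <= p * m1.
  apply: le_trans (ler_wpM2l p'0 m01) _; rewrite mulrA; apply: ler_wpM2r => //.
  apply: le_trans pp'; apply: ler_wpM2l => //.
  by apply: lerXn2r; rewrite ?nnegrE; lra.
have hq : 0 <= q%:R * (p * m1 - p' * m0) by rewrite mulr_ge0// subr_ge0.
have : p * (f1 - q%:R * - m1) <= p * f0 by rewrite ler_wpM2l.
lra.
Qed.
End Potential.

(** * Random subsets and interpolation *)
Section RandomSubset.
Context (R : realType) (T : finType) (p : R).
Implicit Types (g : {set T}) (e : T).

Definition subset_pmf g := \prod_(e : T) bernoulli_pmf p (e \in g).

Lemma subset_pmf_ge0 g : 0 <= p <= 1 -> 0 <= subset_pmf g.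
Proof. by move=> p01; apply: prodr_ge0 => e _; exact: bernoulli_pmf_ge0. Qed.

Lemma subset_pmf_sum1 : \sum_(g : {set T}) subset_pmf g = 1.
Proof.
transitivity (\prod_(e : T) (p + (1 - p))).
  rewrite bigA_distr; apply: eq_big => [g|g _]; first by rewrite inE.
  by apply: eq_bigr => e _; rewrite /bernoulli_pmf.
by rewrite big1// => e _; rewrite addrC subrK.
Qed.

(** Conditioning on everything but the membership of e. *)
Lemma subset_average e (H : {set T} -> R) :
  \sum_g subset_pmf g * H g =
  \sum_g subset_pmf g * ((1 - p) * H (g :\ e) + p * H (e |: g)).
Proof.
pose pe g := \prod_(f | f != e) bernoulli_pmf p (f \in g).
have pE g : subset_pmf g = bernoulli_pmf p (e \in g) * pe g.
  by rewrite /subset_pmf (bigD1 e).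
have peU g : pe (e |: g) = pe g.
  by apply: eq_bigr => f /negbTE fe; rewrite !inE fe.
have half (F : {set T} -> R) : \sum_g subset_pmf g * F g =
    \sum_(g : {set T} | e \notin g) pe g * ((1 - p) * F g + p * F (e |: g)).
  rewrite (bigID (fun g : {set T} => e \notin g)) /=.
  rewrite [X in _ + X](reindex_onto (fun g : {set T} => e |: g) (fun g : {set T} => g :\ e)) /=; last first.
    by move=> g; rewrite negbK => eg; rewrite finset.setD1K.
  rewrite [X in _ + X](eq_bigl (fun g : {set T} => e \notin g)); last first.
    move=> g; rewrite negbK !inE eqxx /=; apply/eqP/idP => [<-|eg].
      by rewrite !inE eqxx.
    by rewrite finset.setU1K.
  rewrite -big_split /=; apply: eq_bigr => g eg.
  rewrite !pE peU (negbTE eg) !inE eqxx /bernoulli_pmf /=; ring.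
rewrite half [RHS]half; apply: eq_bigr => g eg; congr (_ * _).
have -> : g :\ e = g by apply/finset.setP => f; rewrite !inE; case: eqVneq => // ->; rewrite (negbTE eg).
have -> : (e |: g) :\ e = g by rewrite finset.setU1K.
have -> : e |: (e |: g) = e |: g by rewrite finset.setUA finset.setUid.
ring.
Qed.

Lemma subset_card_mean : \sum_g subset_pmf g * #|g|%:R = p * #|T|%:R.
Proof.
have -> : \sum_g subset_pmf g * #|g|%:R =
    \sum_(e : T) \sum_g subset_pmf g * (e \in g)%:R.
  rewrite exchange_big /=; apply: eq_bigr => g _.
  rewrite -mulr_sumr -sum1_card natr_sum big_mkcond /=; congr (_ * _).
  by apply: eq_bigr => e _; case: (e \in g).
have h e : \sum_g subset_pmf g * (e \in g)%:R = p.
  transitivity (\sum_g subset_pmf g * p); last first.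
    by rewrite -mulr_suml subset_pmf_sum1 mul1r.
  rewrite (@subset_average e); apply: eq_bigr => g _.
  rewrite !inE eqxx /=; ring.
by rewrite (eq_bigr _ (fun e _ => h e)) sumr_const mulr_natr.
Qed.
End RandomSubset.

Section Interpolation.
Context (R : realType) (m : nat) (T : finType) (x : T -> 'cV[R]_m.+1).

Lemma sym_ge_sum (P : pred T) c : 0 <= c ->
  sym_ge 0 (\sum_(e | P e) c *: (x e *m (x e)^T)).
Proof.
move=> c0; apply: (big_ind (fun M => @sym_ge R m 0 M)).
- split; first by rewrite trmx0.
  by move=> y; rewrite mul0mx dot0r mul0r.
- by move=> A B; exact: sym_geD.
by move=> e _; exact: sym_ge_rank1.
Qed.

(** Lindeberg's replacement argument: the random terms are exchanged one after
    the other for deterministic ones of weight p', by potential_step applied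
    conditionally on the other terms. *)
Lemma potential_mean_le (K p p' r : R) (A : 'M[R]_m.+1) q : 0 < K -> sym_ge K A ->
  0 <= p <= 1 -> 0 <= p' -> (forall e, sqnorm2 (x e) <= r) ->
  p' * (1 + r / K) ^+ q.+1 <= p ->
  \sum_(g : {set T}) subset_pmf p g *
     potential q (A + \sum_(e in g) x e *m (x e)^T) <=
  potential q (A + p' *: \sum_e x e *m (x e)^T).
Proof.
move=> K0 hA p01 p'0 xr hp'.
(* In N g s the terms of s have been replaced, the others are still random. *)
pose N (g : {set T}) (s : seq T) := A + (\sum_(e in g | e \notin s) 1 *: (x e *m (x e)^T) +
   \sum_(e | e \in s) p' *: (x e *m (x e)^T)).
have hN g s : sym_ge K (N g s).
  by do 2![apply: sym_geD => //]; exact: sym_ge_sum.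
have N0 (g : {set T}) : N g [::] = A + \sum_(e in g) x e *m (x e)^T.
  rewrite /N [X in _ + (_ + X)]big_pred0// addr0; congr (_ + _).
  by apply: eq_big => [e|e _]; rewrite ?andbT ?scale1r.
have N1 (g : {set T}) : N g (enum T) = A + p' *: \sum_e x e *m (x e)^T.
  rewrite /N big_pred0 ?add0r; last by move=> e; rewrite mem_enum andbF.
  by rewrite scaler_sumr; congr (_ + _); apply: eq_bigl => e; rewrite mem_enum.
suff step s : uniq s ->
  \sum_(g : {set T}) subset_pmf p g * potential q (N g [::]) <=
  \sum_(g : {set T}) subset_pmf p g * potential q (N g s).
  have := step _ (enum_uniq T).
  under eq_bigr do rewrite N0.
  by under [X in _ <= X -> _]eq_bigr do rewrite N1; rewrite -mulr_suml subset_pmf_sum1 mul1r.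
elim: s => [//|e s IH] /= /andP[es us]; apply: le_trans (IH us) _.
rewrite (@subset_average _ _ _ e); apply: ler_sum => g _.
apply: ler_wpM2l; first exact: subset_pmf_ge0.
pose M := A + (\sum_(f in g | f \notin e :: s) 1 *: (x f *m (x f)^T) +
   \sum_(f | f \in s) p' *: (x f *m (x f)^T)).
have hM : sym_ge K M.
  by do 2![apply: sym_geD => //]; exact: sym_ge_sum.
have -> : N (g :\ e) s = M.
  rewrite /N /M; congr (_ + (_ + _)); apply: eq_bigl => f.
  by rewrite !inE; case: eqVneq => //= _; rewrite andbF.
have -> : N (e |: g) s = M + x e *m (x e)^T.
  have S : \sum_(f in e |: g | f \notin s) 1 *: (x f *m (x f)^T) =
      x e *m (x e)^T + \sum_(f in g | f \notin e :: s) 1 *: (x f *m (x f)^T).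
    rewrite (bigD1 e) /=; last by rewrite !inE eqxx.
    rewrite scale1r; congr (_ + _); apply: eq_bigl => f; rewrite !inE.
    by case: eqVneq => //= _; rewrite ?andbF ?andbT.
  by rewrite /N /M S -!addrA; congr (_ + _); rewrite addrC -addrA.
have -> : N g (e :: s) = M + p' *: (x e *m (x e)^T).
  have S : \sum_(f | f \in e :: s) p' *: (x f *m (x f)^T) =
      p' *: (x e *m (x e)^T) + \sum_(f | f \in s) p' *: (x f *m (x f)^T).
    rewrite (bigD1 e) /=; last by rewrite !inE eqxx.
    congr (_ + _); apply: eq_bigl => f; rewrite !inE.
    by case: eqVneq => [->|] //=; rewrite ?andbF ?andbT// (negbTE es).
  by rewrite /N /M S -!addrA; congr (_ + (_ + _)); exact: addrC.
have [p0 p1] := andP p01.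
apply: (@potential_step _ _ K) => //.
apply: le_trans hp'; apply: ler_wpM2l => //.
have h : 1 + sqnorm2 (x e) / K <= 1 + r / K by rewrite lerD2l ler_pM2r ?invr_gt0.
have h0 : 0 <= sqnorm2 (x e) / K by rewrite divr_ge0 ?sqnorm2_ge0 ?ltW.
by apply: lerXn2r => //; rewrite nnegrE; lra.
Qed.
End Interpolation.

(** * Graph Laplacians *)
Section Laplacian.
Context (R : realType).

Lemma dot_design n (e : edge n) (x : 'cV[R]_n) :
  dot (design R e) x = x (val e).1 0 - x (val e).2 0.
Proof. by rewrite /design dotBl !dot_delta. Qed.

Lemma sqnorm2_design n (e : edge n) : sqnorm2 (design R e) = 2.
Proof.
have ne : ((val e).1 == (val e).2) = false.
  by apply/eqP => h; have := valP e; rewrite h ltnn.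
rewrite /sqnorm2 dot_design /design.
move: (val e).1 (val e).2 ne => i j ne.
have ne' : (j == i) = false by rewrite eq_sym.
rewrite !mxE ne ne' !eqxx.
by rewrite subr0 sub0r opprK.
Qed.

Lemma dot_ones n (x : 'cV[R]_n) : dot (ones R n) x = \sum_i x i 0.
Proof. by rewrite dotE; apply: eq_bigr => i _; rewrite mxE mul1r. Qed.

Lemma sqnorm2_ones n : sqnorm2 (ones R n) = n%:R.
Proof.
rewrite /sqnorm2 dot_ones (eq_bigr (fun=> 1)) => [|i _]; last by rewrite mxE.
by rewrite sumr_const card_ord.
Qed.

Lemma dot_ones_design n (e : edge n) : dot (ones R n) (design R e) = 0.
Proof. by rewrite dotC dot_design !mxE subrr. Qed.

Lemma dot_sum_rank1 n I (r : seq I) (P : pred I) (y : I -> 'cV[R]_n) u v :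
  dot u ((\sum_(e <- r | P e) y e *m (y e)^T) *m v) =
  \sum_(e <- r | P e) dot (y e) u * dot (y e) v.
Proof.
rewrite mulmx_suml dot_sumr; apply: eq_bigr => e _.
by rewrite dot_mulmx_rank1 (dotC u).
Qed.

Lemma laplacian_sym n (g : graph n) : (laplacian R g)^T = laplacian R g.
Proof.
rewrite /laplacian linear_sum /=; apply: eq_bigr => e _.
by rewrite trmx_mul trmxK.
Qed.

Lemma laplacian_ge0 n (g : graph n) v : 0 <= dot v (laplacian R g *m v).
Proof.
rewrite /laplacian dot_sum_rank1; apply: sumr_ge0 => e _.
by rewrite -expr2 sqr_ge0.
Qed.

Lemma laplacian_ones n (g : graph n) : laplacian R g *m ones R n = 0.
Proof.
rewrite /laplacian mulmx_suml big1// => e _; rewrite -mulmxA.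
rewrite [X in _ *m X]mx11_scalar -[X in X%:M]/(dot _ _) dotC dot_ones_design.
by rewrite raddf0 mulmx0.
Qed.

Lemma laplacian_form_ge m (g : graph m.+2) (x : 'cV[R]_m.+2) :
  dot (ones R m.+2) x = 0 ->
  lambda2 (laplacian R g) * sqnorm2 x <= dot x (laplacian R g *m x).
Proof.
apply: lambda2_form_le.
- exact: laplacian_sym.
- exact: laplacian_ge0.
- exact: laplacian_ones.
by rewrite -sqnorm2_eq0 sqnorm2_ones pnatr_eq0.
Qed.

(** The Laplacian of the complete graph is n I - J, where J is the all-ones
    matrix. *)
Lemma complete_laplacian_form n (x : 'cV[R]_n) :
  dot x ((\sum_(e : edge n) design R e *m (design R e)^T) *m x) +
    dot (ones R n) x ^+ 2 = n%:R * sqnorm2 x.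
Proof.
rewrite dot_sum_rank1.
have -> : \sum_(e : edge n) dot (design R e) x * dot (design R e) x =
    \sum_(i < n) \sum_(j < n | (i < j)%N) (x i 0 - x j 0) ^+ 2.
  rewrite pair_big_dep /=.
  rewrite (big_sub [pred u : 'I_n * 'I_n | (u.1 < u.2)%N]
    (fun u : 'I_n * 'I_n => (x u.1 0 - x u.2 0) ^+ 2)).
  by apply: eq_bigr => e _; rewrite dot_design expr2.
have dbl : 2 * \sum_(i < n) \sum_(j < n | (i < j)%N) (x i 0 - x j 0) ^+ 2 =
    \sum_i \sum_j (x i 0 - x j 0) ^+ 2.
  rewrite mulr_natl mulr2n.
  have -> : \sum_i \sum_j (x i 0 - x j 0) ^+ 2 =
     \sum_(i < n) \sum_(j < n | (i < j)%N) (x i 0 - x j 0) ^+ 2 +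
     \sum_(i < n) \sum_(j < n | (j < i)%N) (x i 0 - x j 0) ^+ 2.
    rewrite -big_split /=; apply: eq_bigr => i _.
    rewrite (bigID (fun j : 'I_n => (i < j)%N)) /=; congr (_ + _).
    rewrite (bigID (fun j : 'I_n => (j < i)%N)) /= [X in _ + X]big1 ?addr0.
      by apply: eq_bigl => j; case: ltngtP.
    move=> j; rewrite -!leqNgt => /andP[h1 h2].
    have -> : i = j by apply/val_inj/eqP; rewrite eqn_leq h1 h2.
    by rewrite subrr expr0n.
  congr (_ + _); rewrite (exchange_big_dep xpredT) //=.
  by apply: eq_bigr => i _; apply: eq_bigr => j _; ring.
have exp : \sum_i \sum_j (x i 0 - x j 0) ^+ 2 =
    2 * (n%:R * sqnorm2 x) - 2 * dot (ones R n) x ^+ 2.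
  rewrite dot_ones sqnorm2E.
  transitivity (\sum_i (n%:R * x i 0 ^+ 2 - 2 * x i 0 * (\sum_j x j 0) +
      \sum_j x j 0 ^+ 2)).
    apply: eq_bigr => i _.
    rewrite mulr_sumr (_ : n%:R * _ = \sum_(j < n) x i 0 ^+ 2); last first.
      by rewrite sumr_const card_ord mulr_natl.
    by rewrite -sumrB -big_split /=; apply: eq_bigr => j _; ring.
  rewrite big_split /= sumrB -mulr_sumr -mulr_suml -mulr_sumr sumr_const card_ord.
  by rewrite -[(\sum_j x j 0 ^+ 2) *+ n]mulr_natl; ring.
move: dbl exp; lra.
Qed.

End Laplacian.

(** * The second eigenvalue of a random graph *)
Section Tail.
Context (R : realType).

Lemma potential_ge m K q (M : 'M[R]_m.+1) v t : 0 < K -> sym_ge K M ->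
  v != 0 -> dot v (M *m v) <= t * sqnorm2 v -> t^-1 ^+ q <= potential q M.
Proof.
move=> K0 hM v0 vt; have [U [d [UU ME dK _ pM]]] := potential_spectral K0 hM.
have [k dk] : exists k, d k <= t.
  apply/not_existsP => h; move: vt.
  rewrite leNgt => /negP; apply.
  rewrite ME dot_spectral_fun// /sqnorm2 -(dot_orth UU) dotE mulr_sumr.
  have v2 : 0 < sqnorm2 v by rewrite lt0r sqnorm2_ge0 sqnorm2_eq0 v0.
  have dt k : t < d k by rewrite ltNge; apply/negP/h.
  have [k vk] : exists k, (U *m v) k 0 != 0.
    apply/not_existsP => z; move: v0; rewrite -(mul1mx v) -UU -mulmxA => /eqP; apply.
    suff -> : U *m v = 0 by rewrite mulmx0.
    by apply/colP => k; rewrite [RHS]mxE; apply/eqP/negPn/negP/z.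
  rewrite (bigD1 k)//= [X in _ < X](bigD1 k)//=; apply: ltr_leD.
    by rewrite -[X in _ < X]mulrA ltr_pM2r ?dt// -expr2 lt0r sqr_ge0 sqrf_eq0 vk.
  apply: ler_sum => l _; rewrite -[leRHS]mulrA; apply: ler_wpM2r.
    by rewrite -expr2 sqr_ge0.
  exact: ltW.
have d0 l : 0 < d l by exact: lt_le_trans (dK l).
rewrite pM (bigD1 k)//= -[leLHS]addr0; apply: lerD.
  have t0 : 0 < t by exact: lt_le_trans dk.
  by apply: lerXn2r; rewrite ?nnegrE ?lef_pV2 ?posrE// invr_ge0 ltW.
by apply: sumr_ge0 => l _; rewrite exprn_ge0// invr_ge0 ltW.
Qed.

Lemma potential_le m K q (M : 'M[R]_m.+1) : 0 < K -> sym_ge K M ->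
  potential q M <= m.+1%:R * K^-1 ^+ q.
Proof.
move=> K0 hM; have [U [d [UU ME dK _ pM]]] := potential_spectral K0 hM.
have d0 l : 0 < d l by exact: lt_le_trans (dK l).
rewrite pM mulr_natl -[X in _ *+ X](card_ord m.+1) -sumr_const.
apply: ler_sum => k _.
by apply: lerXn2r; rewrite ?nnegrE ?lef_pV2 ?posrE// invr_ge0 ltW.
Qed.

(** Markov's inequality for the potential of K I + p' J + L_G.  The term p' J
    lifts the eigenvalue 0 of L_G on the constants, without which the potential
    would not see lambda2; it also completes p' times the Laplacian of the
    complete graph to the multiple n p' of the identity. *)
Lemma lambda2_tail m (p p' K t : R) q : 0 < K -> 0 <= p <= 1 -> 0 <= p' -> 0 < t ->
  p' * (1 + 2 / K) ^+ q.+1 <= p ->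
  \sum_(g : graph m.+2 | lambda2 (laplacian R g) < t) graph_pmf p g <=
  m.+2%:R * ((K + t) / (K + m.+2%:R * p')) ^+ q.
Proof.
move=> K0 p01 p'0 t0 hp'; pose J := ones R m.+2 *m (ones R m.+2)^T.
pose A := K%:M + p' *: J.
have hK : sym_ge K (K%:M : 'M[R]_m.+2).
  by split; [rewrite tr_scalar_mx | move=> x; rewrite mul_scalar_mx dotZr].
have hA : sym_ge K A by apply: sym_geD => //; exact: sym_ge_rank1.
have hL (g : graph m.+2) : sym_ge K (A + laplacian R g).
  apply: sym_geD => //; split; first exact: laplacian_sym.
  by move=> x; rewrite mul0r laplacian_ge0.
have x2 (e : edge m.+2) : sqnorm2 (design R e) <= 2 by rewrite sqnorm2_design.
pose L : 'M[R]_m.+2 := \sum_(e : edge m.+2) design R e *m (design R e)^T.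
have mean : \sum_(g : graph m.+2) subset_pmf p g *
     potential q (A + laplacian R g) <= potential q (A + p' *: L).
  exact: potential_mean_le K0 hA p01 p'0 x2 hp'.
have KL : sym_ge (K + m.+2%:R * p') (A + p' *: L).
  split.
    have [sA _] := hA; rewrite linearD /= sA linearZ /= /L linear_sum /=.
    congr (_ + _ *: _); apply: eq_bigr => e _; by rewrite trmx_mul trmxK.
  move=> x; rewrite /A mulrDl !mulmxDl !dotDr mul_scalar_mx dotZr -!scalemxAl !dotZr.
  rewrite dot_mulmx_rank1 (dotC x) -expr2.
  have := complete_laplacian_form x; rewrite -/L /sqnorm2 => h.
  by rewrite -addrA lerD2l -mulrDr addrC h mulrA [m.+2%:R * _]mulrC.
have Kp0 : 0 < K + m.+2%:R * p' by rewrite ltr_wpDr// mulr_ge0.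
have up := le_trans mean (potential_le q Kp0 KL).
have lo : (\sum_(g : graph m.+2 | lambda2 (laplacian R g) < t) graph_pmf p g) *
    (K + t)^-1 ^+ q <= \sum_(g : graph m.+2) subset_pmf p g *
     potential q (A + laplacian R g).
  rewrite mulr_suml [leRHS](bigID (fun g : graph m.+2 => lambda2 (laplacian R g) < t)) /=.
  rewrite -[leLHS]addr0; apply: lerD; last first.
    apply: sumr_ge0 => g _; rewrite mulr_ge0 ?subset_pmf_ge0//.
    have [U [d [UU ME dK _ pM]]] := potential_spectral K0 (hL g).
    rewrite pM; apply: sumr_ge0 => l _; rewrite exprn_ge0// invr_ge0.
    by rewrite (le_trans (ltW K0)).
  apply: ler_sum => g gt; apply: ler_wpM2l; first exact: subset_pmf_ge0.
  have [v [v0 ov lv]] := lambda2_witness (ones R m.+2) (laplacian_sym R g).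
  apply: (potential_ge q K0 (hL g) v0).
  rewrite /A !mulmxDl !dotDr mul_scalar_mx dotZr -!scalemxAl !dotZr.
  rewrite dot_mulmx_rank1 (dotC v (ones _ _)) ov mul0r mulr0 addr0 mulrDl.
  rewrite lerD2l; apply: le_trans lv _; apply: ler_wpM2r; first exact: sqnorm2_ge0.
  exact: ltW.
have Kt : 0 < K + t by rewrite addr_gt0.
have := le_trans lo up; rewrite exprVn -ler_pdivlMr ?invr_gt0 ?exprn_gt0//.
by rewrite invrK -mulrA exprMn [X in _ * X]mulrC.
Qed.

(** 9/20 = 1/2 - 1/20 leaves room, in tail_ratio_le, for the regularization
    K = np/20. *)
Lemma expRN1_le : expR (- 1) <= 9 / 20 :> R.
Proof.
have h : 3 / 2 <= expR (2^-1) :> R.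
  by apply: le_trans (expR_ge1Dx _); lra.
have e : expR (- 1) * (expR 2^-1 * expR 2^-1) = 1 :> R.
  by rewrite -!expRD -[RHS]expR0; congr expR; lra.
have h2 : (3 / 2) * (3 / 2) <= expR (2^-1) * expR (2^-1) :> R by rewrite ler_pM.
have := expR_gt0 (- 1 : R); move: (expR (-1)) (_ * expR _) h2 e => a b h2 e a0.
have : a * (3/2 * (3/2)) <= a * b by rewrite ler_wpM2l// ltW.
lra.
Qed.

Lemma ln2_ge : 2^-1 <= ln 2 :> R.
Proof.
rewrite -ler_expR lnK ?posrE//.
have h : 1 - 2^-1 <= expR (- 2^-1) :> R by exact: expR_ge1Dx.
have e : expR (2^-1) * expR (- 2^-1) = 1 :> R by rewrite expRxMexpNx_1.
have := expR_gt0 (2^-1 : R); move: (expR (- 2^-1)) (expR 2^-1) h e => b a h e a0.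
have : a * (1 - 2^-1) <= a * b by rewrite ler_wpM2l// ltW.
lra.
Qed.

Lemma trunc_log_le n : (2 <= n)%N -> (trunc_log 2 n)%:R <= 2 * ln n%:R :> R.
Proof.
move=> n2; have n0 : (0 < n)%N by exact: leq_trans n2.
have h : (2 ^ trunc_log 2 n <= n)%N by exact: trunc_logP.
have : ln ((2 ^ trunc_log 2 n)%:R) <= ln n%:R :> R.
  by rewrite ler_ln ?posrE ?ltr0n ?expn_gt0 ?n0// ler_nat.
rewrite natrX lnXn// -[_ *+ _]mulr_natl => h2.
have : (trunc_log 2 n)%:R * 2^-1 <= (trunc_log 2 n)%:R * ln 2 :> R.
  by rewrite ler_wpM2l// ln2_ge.
lra.
Qed.

Lemma ln_nat_ge n : (2 <= n)%N -> 2^-1 <= ln n%:R :> R.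
Proof.
move=> n2; apply: le_trans ln2_ge _.
by rewrite ler_ln ?posrE ?ltr0n ?(leq_trans _ n2)// ler_nat.
Qed.

(** From (1 + y)^k (1 - y)^k <= 1 and Bernoulli's inequality for (1 - y)^k. *)
Lemma pow_one_plus_le (y : R) N : 0 < y -> N.+1%:R * y <= 20^-1 ->
  19 / 20 * (1 + y) ^+ N.+1 <= 1.
Proof.
move=> y0 hy.
have y1 : y <= 20^-1.
  by apply: le_trans hy; rewrite -[leLHS]mul1r ler_pM2r// ler1n.
have b : 19 / 20 <= (1 - y) ^+ N.+1.
  have y1' : 0 <= 1 - y by lra.
  by apply: le_trans (bernoulli_ineq N.+1 y1'); lra.
have c : (1 - y) ^+ N.+1 * (1 + y) ^+ N.+1 <= 1.
  rewrite -exprMn; apply: exprn_ile1; first by rewrite mulr_ge0; lra.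
  by rewrite -subr_ge0 (_ : 1 - _ = y ^+ 2) ?sqr_ge0//; ring.
by apply: le_trans c; apply: ler_wpM2r b; rewrite exprn_ge0; lra.
Qed.

(** Used twice, this turns (1/2)^q into n^{-2}: one factor 1/n absorbs the
    dimension, the other one is the final bound. *)
Lemma half_pow_trunc_log_le n : (0 < n)%N ->
  (2^-1) ^+ (trunc_log 2 n).+1 <= n%:R^-1 :> R.
Proof.
move=> n0; rewrite exprVn lef_pV2 ?posrE ?exprn_gt0 ?ltr0n// -natrX ler_nat.
by rewrite ltnW// trunc_log_ltn.
Qed.

Lemma moment_order_le n : (2 <= n)%N ->
  ((trunc_log 2 n).+1 + (trunc_log 2 n).+1).+1%:R <= 10 * ln n%:R :> R.
Proof.
move=> n2; have := ln_nat_ge n2; have := trunc_log_le n2.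
move: (trunc_log 2 n) => t; rewrite addSn addnS -addn3 !natrD; lra.
Qed.

Lemma tail_ratio_le (x : R) : 0 < x ->
  0 <= (x / 20 + expR (- 1) * x) / x <= 2^-1.
Proof.
move=> x0; have e0 := expR_gt0 (- 1 : R); apply/andP; split.
  by rewrite divr_ge0 ?(ltW x0)// addr_ge0 ?mulr_ge0 ?divr_ge0 ?ltW.
rewrite ler_pdivrMr//; have := ler_wpM2r (ltW x0) expRN1_le; lra.
Qed.

(** The tail bound with K = np/20, p' = 19p/20 and t = np/e, for which
    K + n p' = np and the ratio is at most 1/2; the exponent is
    q = 2 (trunc_log 2 n + 1).  The constant 20^3 makes np at least
    800 (q + 1), so that (1 + 2/K)^{q+1} <= 20/19. *)
Lemma lambda2_small_prob n (p : R) : (2 <= n)%N ->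
  20 ^+ 3 * ln n%:R / n%:R <= p -> p <= 1 ->
  \sum_(g : graph n | lambda2 (laplacian R g) < expR (- 1) * n%:R * p)
     graph_pmf p g <= n%:R^-1.
Proof.
case: n => [//|[//|m]] n2 hp p1.
have n0 : 0 < m.+2%:R :> R by [].
pose L := (trunc_log 2 m.+2).+1; pose q := (L + L)%N.
have [x xE] : exists x, x = m.+2%:R * p by eexists.
(* With y = 2 / K = 40 / x the condition (q + 1) y <= 1/20 reads
   800 (q + 1) <= x. *)
have hx : 20 * 20 * 2 * q.+1%:R <= x.
  apply: (@le_trans _ _ (20 * 20 * 2 * (10 * ln m.+2%:R))).
    by rewrite ler_pM2l ?mulr_gt0//; exact: moment_order_le.
  apply: (@le_trans _ _ (20 ^+ 3 * ln m.+2%:R)).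
    by rewrite le_eqVlt; apply/orP; left; apply/eqP; ring.
  by rewrite xE [leRHS]mulrC -ler_pdivrMr.
have x0 : 0 < x by apply: lt_le_trans hx; rewrite !mulr_gt0.
have p0 : 0 < p by rewrite -(pmulr_rgt0 _ n0) -xE.
clear hp; have K0 : 0 < x / 20 by rewrite divr_gt0.
have hp' : 19 / 20 * p * (1 + 2 / (x / 20)) ^+ q.+1 <= p.
  rewrite mulrAC -[leRHS]mul1r; apply: ler_wpM2r; first exact: ltW.
  apply: pow_one_plus_le; first by rewrite divr_gt0.
  rewrite mulrA ler_pdivrMr//; move: hx; move: (q.+1%:R) => z hz; lra.
have p01 : 0 <= p <= 1 by rewrite p1 ltW.
have p'0 : 0 <= 19 / 20 * p by rewrite mulr_ge0 ?divr_ge0// ltW.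
have t0 : 0 < expR (- 1) * m.+2%:R * p by rewrite !mulr_gt0 ?expR_gt0.
have tail := lambda2_tail m K0 p01 p'0 t0 hp'.
apply: (le_trans tail); clear tail hp' p'0 hx.
have -> : x / 20 + m.+2%:R * (19 / 20 * p) = x by rewrite xE; field.
rewrite -mulrA -xE; have /andP[r0 r1] := tail_ratio_le x0.
apply: (@le_trans _ _ (m.+2%:R * (m.+2%:R^-1 * m.+2%:R^-1))).
  apply: ler_wpM2l => //.
  apply: (@le_trans _ _ ((2^-1) ^+ q)); first by rewrite lerXn2r ?nnegrE ?invr_ge0.
  have h : (2^-1) ^+ L <= m.+2%:R^-1 :> R by exact: half_pow_trunc_log_le.
  by rewrite /q exprD ler_pM// exprn_ge0 ?invr_ge0.
by rewrite mulrA mulfV ?gt_eqF// mul1r.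
Qed.
End Tail.

(** * Strong convexity of the extended logistic loss *)
Section Phibar.
Context (R : realType).
Implicit Types s t : R.

Definition sigma t := expR t / (1 + expR t).

Lemma expRD1_gt0 t : 0 < 1 + expR t.
Proof. by rewrite addr_gt0 ?expR_gt0. Qed.

Lemma is_derive_phi t : is_derive t 1 (@phi R) (sigma t).
Proof.
have h := expRD1_gt0 t.
have d1 : is_derive t 1 (fun u : R => 1 + expR u) (expR t).
  have h1 := is_deriveD (is_derive_cst (1 : R) t 1) (is_derive_expR t).
  apply: is_derive_eq h1 _; exact: add0r.
have d2 := is_derive1_ln h.
have := @is_derive1_comp R (@ln R) (fun u => 1 + expR u) t _ _ d2 d1.
by move=> d; apply: is_derive_eq d _; rewrite /sigma mulrC.
Qed.

Lemma is_derive_sigma t : is_derive t 1 sigma (expR t / (1 + expR t) ^+ 2).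
Proof.
have h := expRD1_gt0 t.
have d1 : is_derive t 1 (fun u : R => 1 + expR u) (expR t).
  have h1 := is_deriveD (is_derive_cst (1 : R) t 1) (is_derive_expR t).
  apply: is_derive_eq h1 _; exact: add0r.
have d2 : is_derive t 1 (fun u : R => (1 + expR u)^-1) (- (1 + expR t)^-2 *: expR t).
  by apply: is_deriveV; rewrite gt_eqF.
have := is_deriveM (is_derive_expR t) d2.
move=> d; apply: is_derive_eq d _.
by rewrite /GRing.scale /=; field; rewrite gt_eqF.
Qed.

(** On [-2, 2] the derivative u / (1 + u)^2 of the logistic function, with
    u = e^t, is smallest at the endpoints, where it is kappa0. *)
Lemma sigma_slope s t : - 2 <= s -> s <= t -> t <= 2 ->
  kappa0 R * (t - s) <= sigma t - sigma s.
Proof.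
move=> s2 st t2.
have [|c cst ->] := @MVT_segment R sigma (fun t => expR t / (1 + expR t) ^+ 2)
  s t st (fun x _ => is_derive_sigma x).
  apply: derivable_within_continuous => x _.
  by apply: ex_derive; exact: is_derive_sigma.
apply: ler_wpM2r; first by rewrite subr_ge0.
move: cst; rewrite in_itv /= => /andP[sc ct].
have u0 := expR_gt0 c; have v0 := expR_gt0 (- 2 : R).
have uv : expR (- 2) <= expR c by rewrite ler_expR; lra.
have w : expR c * expR (- 2) <= 1.
  by rewrite -expRD -[leRHS]expR0 ler_expR; lra.
rewrite /kappa0; move: (expR c) (expR (-2)) u0 v0 uv w => u v u0 v0 uv w.
rewrite ler_pdivrMr ?exprn_gt0 ?addr_gt0// mulrAC ler_pdivlMr ?exprn_gt0 ?addr_gt0//.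
rewrite -subr_ge0 (_ : _ - _ = (u - v) * (1 - u * v)); last by ring.
by rewrite mulr_ge0 ?subr_ge0.
Qed.

(** phi - kappa0 t^2 / 2 has a nondecreasing derivative on [-2, 2]; the mean
    value theorem gives the tangent inequality. *)
Lemma phi_strong_convex s t : - 2 <= s <= 2 -> - 2 <= t <= 2 ->
  phi s + sigma s * (t - s) + kappa0 R / 2 * (t - s) ^+ 2 <= phi t.
Proof.
move=> /andP[s2 s2'] /andP[t2 t2'].
pose h (x : R) : R := phi x - kappa0 R / 2 * x ^+ 2.
pose h' (x : R) : R := sigma x - kappa0 R * x.
have dh (x : R) : is_derive x (1 : R) h (h' x).
  have d := is_derive_phi x.
  have d2 := is_deriveZ (kappa0 R / 2) (is_deriveX 2 (is_derive_id x (1 : R))).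
  have d3 := is_deriveB d d2; apply: is_derive_eq d3 _.
  rewrite /h' /GRing.scale /=.
  by congr (_ - _); rewrite expr1; field.
have ch a b : {within `[a, b], continuous h}.
  apply: derivable_within_continuous => x _.
  by apply: ex_derive; exact: dh.
suff H : h s + h' s * (t - s) <= h t by move: H; rewrite /h /h'; lra.
have [st|ts] := leP s t.
  have [c cst e] := @MVT_segment R h h' s t st (fun x _ => dh x) (ch s t).
  move: cst; rewrite in_itv /= => /andP[sc ct].
  rewrite -lerBrDl e; apply: ler_wpM2r; first by rewrite subr_ge0.
  have := @sigma_slope s c s2 sc (le_trans ct t2'); rewrite /h'; lra.
have [c cst e] := @MVT_segment R h h' t s (ltW ts) (fun x _ => dh x) (ch t s).
move: cst; rewrite in_itv /= => /andP[tc cs].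
have : h' c * (s - t) <= h' s * (s - t).
  apply: ler_wpM2r; first by rewrite subr_ge0 ltW.
  have := @sigma_slope c s (le_trans t2 tc) cs s2'; rewrite /h'; lra.
lra.
Qed.

Definition clamp t := if t < - 2 then - 2 else if 2 < t then 2 else t.

(** The derivative of phibar. *)
Definition slope t := sigma (clamp t) + kappa0 R * (t - clamp t).

Lemma phibarE t : phibar t = phi (clamp t) + sigma (clamp t) * (t - clamp t) +
  kappa0 R / 2 * (t - clamp t) ^+ 2.
Proof.
have d u : derive1 (@phi R) u = sigma u.
  by rewrite derive1E; have := is_derive_phi u => -[_ ->].
rewrite /phibar /clamp !d; case: ifP => _; first by rewrite opprK; ring.
by case: ifP => _; [ring | rewrite subrr; ring].
Qed.

Lemma clampP t : - 2 <= clamp t <= 2.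
Proof. by rewrite /clamp; case: ltP => h1; [|case: ltP => h2]; lra. Qed.

Lemma sigma_gt0 t : 0 < sigma t.
Proof. by rewrite divr_gt0 ?expR_gt0 ?expRD1_gt0. Qed.

Lemma sigma_lt1 t : sigma t < 1.
Proof. by rewrite ltr_pdivrMr ?expRD1_gt0// mul1r ltrDr. Qed.

Lemma kappa0_gt0 : 0 < kappa0 R.
Proof. by rewrite divr_gt0 ?expR_gt0// exprn_gt0 ?expRD1_gt0. Qed.

(** Outside [-2, 2], phibar is the quadratic with second derivative kappa0 that
    matches phi to first order at the endpoint.  So both sides can be compared
    at the clamped points, where phi_strong_convex applies; what is left over is
    the product of t - clamp t with a difference of slopes of the same sign. *)
Lemma phibar_strong_convex s t :
  phibar s + slope s * (t - s) + kappa0 R / 2 * (t - s) ^+ 2 <= phibar t.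
Proof.
rewrite !phibarE /slope.
have := phi_strong_convex (clampP s) (clampP t).
have : 0 <= ((sigma (clamp t) - sigma (clamp s)) -
   kappa0 R * (clamp t - clamp s)) * (t - clamp t).
  have /andP[s1 s2] := clampP s; have /andP[t1 t2] := clampP t.
  have [->|[[tE tt]|[tE tt]]] : clamp t = t \/ (clamp t = 2 /\ 2 < t) \/ (clamp t = - 2 /\ t < - 2).
    by rewrite /clamp; case: ltP => h1; [|case: ltP => h2]; auto.
  - by rewrite subrr mulr0.
  - rewrite tE mulr_ge0//; last by lra.
    have := @sigma_slope (clamp s) 2 s1 s2 (lexx _); lra.
  rewrite tE mulr_le0//; last by lra.
  have := @sigma_slope (- 2) (clamp s) (lexx _) s1 s2; lra.
move: (clamp s) (clamp t) => a b.
move: (phi a) (sigma a) (phi b) (sigma b) (kappa0 R) => pa sa pb sb k.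
rewrite !expr2; lra.
Qed.

Lemma slope_in t : - 2 <= t <= 2 -> slope t = sigma t.
Proof.
move=> /andP[t1 t2]; rewrite /slope (_ : clamp t = t) ?subrr ?mulr0 ?addr0//.
by rewrite /clamp ltNge t1 /= ltNge t2.
Qed.

(** The tangent inequality in both directions bounds the increments of phibar by
    its slope, so it is locally Lipschitz. *)
Lemma continuous_phibar : continuous (@phibar R).
Proof.
have bound s t : `|phibar t - phibar s| <= (1 + kappa0 R * (`|s| + `|t| + 2)) * `|t - s|.
  have k0 := kappa0_gt0.
  have hs u : `|slope u| <= 1 + kappa0 R * (`|u| + 2).
    have := sigma_gt0 (clamp u); have := sigma_lt1 (clamp u).
    have /andP[c1 c2] := clampP u => h1 h2.
    apply: le_trans (ler_normD _ _) _; apply: lerD; first by rewrite gtr0_norm ?ltW.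
    rewrite normrM (gtr0_norm k0); apply: ler_wpM2l; first exact: ltW.
    by apply: le_trans (ler_normB _ _) _; rewrite lerD2l ler_norml c1.
  have sqk u v : 0 <= kappa0 R / 2 * (u - v) ^+ 2.
    by rewrite mulr_ge0 ?sqr_ge0 ?divr_ge0 ?ltW.
  have P u v : slope u * (v - u) <= phibar v - phibar u.
    by have := phibar_strong_convex u v; have := sqk v u; lra.
  have A u : `|u| <= `|s| + `|t| -> `|slope u| <= 1 + kappa0 R * (`|s| + `|t| + 2).
    move=> hu; apply: le_trans (hs u) _; rewrite lerD2l ler_wpM2l ?(ltW k0)// lerD2r//.
  have As := A s (ler_wpDr (normr_ge0 t) (lexx _)).
  have At := A t (ler_wpDl (normr_ge0 s) (lexx _)).
  have Bs := ler_wpM2r (normr_ge0 (t - s)) As.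
  have Bt := ler_wpM2r (normr_ge0 (t - s)) At.
  rewrite -normrM in Bs; rewrite -normrM in Bt.
  move: Bs Bt; rewrite !ler_norml => /andP[Bs _] /andP[_ Bt].
  have p1 := P s t; have p2 := P t s.
  apply/andP; split; lra.
move=> s; apply/cvgrPdist_le => e e0.
pose L := 1 + kappa0 R * (`|s| + (`|s| + 1) + 2).
have L0 : 0 < L.
  by rewrite ltr_wpDr// mulr_ge0 ?(ltW kappa0_gt0)// !addr_ge0.
have d0 : 0 < Num.min 1 (e / L) by rewrite lt_min ltr01 divr_gt0.
near=> t.
have ts : `|s - t| < Num.min 1 (e / L).
  by near: t; apply/nbhs_ballP; exists (Num.min 1 (e / L)) => // t'; exact.
move: ts; rewrite lt_min => /andP[ts1 tsL].
apply: le_trans (bound t s) _.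
apply: (@le_trans _ _ (L * `|s - t|)).
  apply: ler_wpM2r => //; rewrite /L lerD2l ler_wpM2l ?(ltW kappa0_gt0)//.
  have h : `|t| <= `|s| + `|s - t|.
    by rewrite -[X in `|X| <= _](subKr s) ler_normB.
  move: (`|t|) (`|s|) (`|s - t|) h ts1 => a b c; lra.
by rewrite mulrC -ler_pdivlMr// ltW.
Unshelve. all: by end_near.
Qed.
End Phibar.

(** * Topology of column vectors *)
Section Topology.
Context (R : realType).

Lemma trmx_continuous m n : continuous (@trmx R m n).
Proof.
move=> M s /= /nbhs_ballP[e e0 es]; apply/nbhs_ballP; exists e => // N [e0' MN].
by apply: es; split=> // i j; rewrite !mxE; exact: MN.
Qed.

Lemma cV_closed_bounded_compact n (A : set 'cV[R]_n) M : closed A ->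
  (forall v, A v -> forall i, `|v i 0| <= M) -> compact A.
Proof.
move=> cA bA.
have Kc : compact [set r : 'rV[R]_n | forall i, `[- M, M]%classic (r ord0 i)].
  by apply: (@rV_compact _ _ (fun=> `[- M, M]%classic)) => _; exact: segment_compact.
have tc : {within [set r : 'rV[R]_n | forall i, `[- M, M]%classic (r ord0 i)], continuous (@trmx R 1 n)}.
  by apply: continuous_subspaceT; exact: trmx_continuous.
apply: subclosed_compact cA (continuous_compact tc Kc) _ => v Av.
exists v^T; last by rewrite trmxK.
by move=> i /=; rewrite in_itv /= mxE -ler_norml bA.
Qed.

Lemma entry_le_norm n (u : 'cV[R]_n) i : `|u i 0| <= `|u|.
Proof.
rewrite -[leRHS]/(mx_norm u) mx_normrE.
by apply: (le_bigmax _ (fun ij : 'I_n * 'I_1 => `|u ij.1 ij.2|) (i, ord0)).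
Qed.

Lemma norm_le_entries n (u : 'cV[R]_n) c : 0 <= c ->
  (forall i, `|u i 0| <= c) -> `|u| <= c.
Proof.
move=> c0 h; rewrite -[leLHS]/(mx_norm u) mx_normrE; apply/bigmax_leP; split=> //.
by move=> [i j] _ /=; rewrite ord1.
Qed.

Lemma sqr_entry_le n (u : 'cV[R]_n) i : u i 0 ^+ 2 <= sqnorm2 u.
Proof.
rewrite sqnorm2E (bigD1 i)//= lerDl; apply: sumr_ge0 => j _; exact: sqr_ge0.
Qed.

Lemma sqnorm2_le_norm n (u : 'cV[R]_n) : sqnorm2 u <= n%:R * `|u| ^+ 2.
Proof.
rewrite sqnorm2E mulr_natl -[X in _ *+ X](card_ord n) -sumr_const.
apply: ler_sum => i _; rewrite -real_normK ?num_real//.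
by apply: lerXn2r; rewrite ?nnegrE ?entry_le_norm.
Qed.

(** The Lipschitz bound is Euclidean, whereas the topology is that of the sup
    norm; the two norms differ by at most a factor sqrt n. *)
Lemma lipschitz_continuous n (F : 'cV[R]_n -> 'cV[R]_n) c :
  (forall u v, sqnorm2 (F u - F v) <= c * sqnorm2 (u - v)) -> continuous F.
Proof.
move=> lip u s /= /nbhs_ballP[e' e'0 es].
have [e e0 ee'] : exists2 e, 0 < e & e < e'.
  by exists (e' / 2); [rewrite divr_gt0 | rewrite gtr_pMr// invf_lt1// ltr1n].
pose c' := `|c| * n%:R + 1.
have c'0 : 0 < c' by rewrite ltr_wpDl// mulr_ge0.
have d0 : 0 < Num.sqrt (e ^+ 2 / c') by rewrite sqrtr_gt0 divr_gt0 ?exprn_gt0.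
apply/nbhs_ballP; exists (Num.sqrt (e ^+ 2 / c')) => // v.
rewrite mx_norm_ball => uv; apply: es; rewrite mx_norm_ball /ball_ /=.
apply: le_lt_trans ee'.
apply: norm_le_entries; first exact: ltW.
move=> i; rewrite -ler_sqr ?nnegrE ?(ltW e0)// real_normK ?num_real//.
apply: le_trans (sqr_entry_le _ i) _; apply: le_trans (lip u v) _.
have h1 : c * sqnorm2 (u - v) <= `|c| * (n%:R * `|u - v| ^+ 2).
  apply: (@le_trans _ _ (`|c| * sqnorm2 (u - v))).
    by apply: ler_wpM2r; [exact: sqnorm2_ge0 | exact: ler_norm].
  by apply: ler_wpM2l => //; exact: sqnorm2_le_norm.
apply: le_trans h1 _.
have h2 : `|u - v| ^+ 2 <= e ^+ 2 / c'.
  rewrite -[leRHS]sqr_sqrtr; last by rewrite divr_ge0 ?sqr_ge0 ?ltW.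
  by apply: lerXn2r; rewrite ?nnegrE ?sqrtr_ge0// ltW.
apply: (@le_trans _ _ (c' * `|u - v| ^+ 2)).
  by rewrite mulrA; apply: ler_wpM2r; [exact: sqr_ge0 | rewrite /c' lerDl].
by rewrite mulrC -ler_pdivlMr.
Qed.

Lemma continuous_sumR (T : topologicalType) I (r : seq I) (P : pred I) (F : I -> T -> R) :
  (forall i, P i -> continuous (F i)) ->
  continuous (fun x => \sum_(i <- r | P i) F i x).
Proof.
move=> h; elim: r => [|i r IH].
  rewrite (_ : (fun _ => _) = cst 0); first exact: cst_continuous.
  by apply/funext => x; rewrite big_nil.
case Pi : (P i); last first.
  rewrite (_ : (fun _ => _) = (fun x => \sum_(i <- r | P i) F i x))//.
  by apply/funext => x; rewrite big_cons Pi.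
rewrite (_ : (fun _ => _) = (fun x => F i x + \sum_(i <- r | P i) F i x)); last first.
  by apply/funext => x; rewrite big_cons Pi.
by move=> x; apply: cvgD; [exact: h | exact: IH].
Qed.

Lemma continuous_dot n (w : 'cV[R]_n) : continuous (dot w).
Proof.
have -> : dot w = (fun z => \sum_i w i 0 * z i 0) by apply/funext => z; exact: dotE.
apply: continuous_sumR => i _ x; apply: continuousM; first exact: cst_continuous.
exact: coord_continuous.
Qed.

Lemma continuous_sqnorm2 n : continuous (@sqnorm2 R n).
Proof.
have -> : @sqnorm2 R n = (fun z => \sum_i z i 0 ^+ 2) by apply/funext => z; exact: sqnorm2E.
apply: continuous_sumR => i _ x.
rewrite (_ : (fun _ => _) = (fun z : 'cV[R]_n => z i 0 * z i 0)); last first.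
  by apply/funext => z; rewrite expr2.
by apply: continuousM; exact: coord_continuous.
Qed.
End Topology.

(** * Minimizers of strongly convex functions under a linear tilt *)
Section Argmin.
Context (R : realType) (n : nat).
Implicit Types (D : set 'cV[R]_n) (f h : 'cV[R]_n -> R) (w z : 'cV[R]_n).

Lemma argmin_over_ext D f g :
  (forall x z, D x -> D z -> (f x <= f z) = (g x <= g z)) ->
  argmin_over D f = argmin_over D g.
Proof.
move=> fg; rewrite /argmin_over; congr xget; apply/seteqP; split=> x /= [Dx h].
  by split=> // z Dz; rewrite -fg// h.
by split=> // z Dz; rewrite fg// h.
Qed.

(** The tangent form of mu-strong convexity: g is a subgradient at s. *)
Definition strongly_convex mu D h := forall s, D s -> exists g, forall t, D t ->
  h s + dot g (t - s) + mu / 2 * sqnorm2 (t - s) <= h t.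

(** For a closed set this is the same as convexity. *)
Definition midpoint_closed D := forall x z, D x -> D z -> D (2^-1 *: (x + z)).

Definition tilt h w z := h z + dot w z.

Context (mu : R) (D : set 'cV[R]_n) (h : 'cV[R]_n -> R) (z0 : 'cV[R]_n).
Hypotheses (mu0 : 0 < mu) (Dcl : closed D) (Dz0 : D z0) (Dmid : midpoint_closed D)
  (hc : continuous h) (hconv : strongly_convex mu D h).

(** From 0 <= |2 a + mu d|^2; equivalently, |d| <= (2/mu) |a| by
    Cauchy-Schwarz. *)
Lemma linear_quadratic_bound (a d : 'cV[R]_n) :
  dot a d + mu / 2 * sqnorm2 d <= 0 -> sqnorm2 d <= 4 / mu ^+ 2 * sqnorm2 a.
Proof.
move=> had; have := sqnorm2_ge0 (2 *: a + mu *: d).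
rewrite /sqnorm2 !(dotDl, dotDr, dotZl, dotZr) (dotC d a) -/(sqnorm2 a) -/(sqnorm2 d).
move: (sqnorm2 a) (sqnorm2 d) (dot a d) had => A d2 ad had h2.
have mu2 : 0 < mu ^+ 2 by rewrite exprn_gt0.
rewrite mulrAC ler_pdivlMr//.
have : mu * (ad + mu / 2 * d2) <= 0 by rewrite mulr_ge0_le0// ltW.
rewrite expr2; lra.
Qed.

Lemma continuous_tilt w : continuous (tilt h w).
Proof.
move=> x; have H := @continuousD _ _ _ h (dot w) x (hc (x := x)) (@continuous_dot _ _ w x).
exact: H.
Qed.

(** The quadratic lower bound makes the sublevel set of z0 bounded, hence
    compact, so that the infimum is attained. *)
Lemma argmin_exists w : let z := argmin_over D (tilt h w) in
  D z /\ forall y, D y -> tilt h w z <= tilt h w y.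
Proof.
pose S := D `&` [set z | tilt h w z <= tilt h w z0].
have [g hg] := hconv Dz0.
have Sb z : S z -> sqnorm2 z <= 2 * (4 / mu ^+ 2 * sqnorm2 (g + w)) + 2 * sqnorm2 z0.
  move=> [Dz]; rewrite /= /tilt => hz.
  have e : z = (z - z0) + z0 by rewrite subrK.
  rewrite [in leLHS]e; apply: le_trans (sqnorm2D_le _ _) _.
  rewrite lerD2r ler_pM2l//; apply: linear_quadratic_bound.
  have := hg z Dz; rewrite dotDl dotBr [dot w _]dotBr; lra.
have Scl : closed S.
  apply: closedI => //.
  rewrite -[X in closed X]/(tilt h w @^-1` [set x | x <= tilt h w z0]).
  by apply: closed_comp => [x _|]; [exact: continuous_tilt | exact: closed_le].
have Sc : compact S.
  apply: (@cV_closed_bounded_compact _ _ _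
    (1 + (2 * (4 / mu ^+ 2 * sqnorm2 (g + w)) + 2 * sqnorm2 z0))) => // z Sz i.
  have := le_trans (sqr_entry_le z i) (Sb z Sz).
  rewrite -[z i 0 ^+ 2]real_normK ?num_real//.
  move: (`|z i 0|) (normr_ge0 (z i 0)) => x x0 hx.
  have := sqr_ge0 (x - 1); move: hx; rewrite !expr2; lra.
have S0 : S !=set0 by exists z0; split => //=.
have [] := compact_EVT_min S0 Sc (continuous_subspaceT (@continuous_tilt w)).
move=> c; rewrite inE => -[Dc cz0] cmin z.
rewrite {}/z /argmin_over; case: xgetP => [z -> []//|/(_ c) []].
split=> // y Dy.
have [yz0|yz0] := leP (tilt h w y) (tilt h w z0).
  by apply: cmin; rewrite inE; split.
by apply: le_trans cz0 (ltW yz0).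
Qed.

Lemma strongly_convex_mid x y : D x -> D y ->
  h (2^-1 *: (x + y)) <= (h x + h y) / 2 - mu / 8 * sqnorm2 (x - y).
Proof.
move=> Dx Dy; have [g hg] := hconv (Dmid Dx Dy).
have := hg _ Dx; have := hg _ Dy.
have -> : x - 2^-1 *: (x + y) = 2^-1 *: (x - y).
  by apply/colP => i; rewrite !mxE; field.
have -> : y - 2^-1 *: (x + y) = - (2^-1 *: (x - y)).
  by apply/colP => i; rewrite !mxE; field.
rewrite sqnorm2N sqnorm2Z dotNr; lra.
Qed.

(** Minimality is tested at the midpoint of the minimizer and y. *)
Lemma argmin_quadratic w y : D y ->
  tilt h w (argmin_over D (tilt h w)) +
    mu / 4 * sqnorm2 (argmin_over D (tilt h w) - y) <= tilt h w y.
Proof.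
move=> Dy; have [Dz zmin] := argmin_exists w.
have := zmin _ (Dmid Dz Dy); have := strongly_convex_mid Dz Dy.
rewrite /tilt dotZr dotDr; lra.
Qed.

(** Each minimizer is a competitor in the problem of the other one; in the sum
    of the two inequalities of argmin_quadratic only the tilts survive. *)
Lemma argmin_lipschitz w1 w2 :
  sqnorm2 (argmin_over D (tilt h w1) - argmin_over D (tilt h w2)) <=
  4 / mu ^+ 2 * sqnorm2 (w1 - w2).
Proof.
have [D1 _] := argmin_exists w1; have [D2 _] := argmin_exists w2.
have := argmin_quadratic w2 D1; have := argmin_quadratic w1 D2.
move: (argmin_over D (tilt h w1)) (argmin_over D (tilt h w2)) => z1 z2.
rewrite -(sqnorm2N (z2 - z1)) opprB => q1 q2.
apply: linear_quadratic_bound; move: q1 q2; rewrite /tilt dotBl !dotBr; lra.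
Qed.

Lemma argmin_continuous : continuous (fun w => argmin_over D (tilt h w)).
Proof. by apply: (@lipschitz_continuous _ _ _ (4 / mu ^+ 2)) => u v; exact: argmin_lipschitz. Qed.

(** The tangent inequality at s bounds the objective from below at the
    minimizer, and minimality bounds it from above by its value at s. *)
Lemma argmin_dist w s g : D s ->
  (forall t, D t -> h s + dot g (t - s) + mu / 2 * sqnorm2 (t - s) <= h t) ->
  sqnorm2 (argmin_over D (tilt h w) - s) <= 4 / mu ^+ 2 * sqnorm2 (g + w).
Proof.
move=> Ds hg; have [Dz zmin] := argmin_exists w; apply: linear_quadratic_bound.
have := zmin _ Ds; have := hg _ Dz; rewrite /tilt dotDl [dot w (_ - _)]dotBr; lra.
Qed.
End Argmin.

(** * The estimator *)
Section Estimator.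
Context (R : realType).

Lemma orth1_closed n : closed (@orth1 R n).
Proof.
rewrite -[X in closed X]/(dot (ones R n) @^-1` [set x | x = 0]).
by apply: closed_comp => [x _|]; [exact: continuous_dot | exact: closed_eq].
Qed.

Lemma Theta_closed n : closed (@Theta R n).
Proof.
apply: closedI; last exact: orth1_closed.
rewrite -[X in closed X]/((fun x : 'cV[R]_n => `|x|) @^-1` [set x | x <= 1]).
by apply: closed_comp => [x _|]; [exact: norm_continuous | exact: closed_le].
Qed.

Lemma orth1_0 n : @orth1 R n 0.
Proof. by rewrite /orth1 /= dot0r. Qed.

Lemma Theta_0 n : @Theta R n 0.
Proof. by split; [rewrite normr0 | exact: orth1_0]. Qed.

Lemma orth1_mid n : midpoint_closed (@orth1 R n).
Proof.
by move=> x z; rewrite /orth1 /= dotZr dotDr => -> ->; rewrite addr0 mulr0.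
Qed.

Lemma Theta_mid n : midpoint_closed (@Theta R n).
Proof.
move=> x z [x1 ox] [z1 oz]; split; last exact: orth1_mid.
rewrite normrZ ger0_norm ?invr_ge0//.
have := ler_normD x z; lra.
Qed.

Lemma sqnorm2_strongly_convex n (D : set 'cV[R]_n) :
  strongly_convex 2 D (@sqnorm2 R n).
Proof.
move=> s _; exists (2 *: s) => t _.
by rewrite /sqnorm2 dotZl !(dotBr, dotBl) (dotC t s); lra.
Qed.

(** |y - x|^2 differs from |y|^2 - 2 <x, y> by a constant: the projection is the
    minimizer of a tilted squared norm, so the bounds on minimizers apply. *)
Lemma proj_onto_tilt n (D : set 'cV[R]_n) x :
  proj_onto D x = argmin_over D (tilt (@sqnorm2 R n) (- (2 *: x))).
Proof.
apply: argmin_over_ext => y z _ _; rewrite /tilt !dotNl !dotZl.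
rewrite /sqnorm2 !(dotBr, dotBl) (dotC y x) (dotC z x).
by apply/idP/idP; lra.
Qed.

Lemma proj_Theta_in n x : Theta (proj_onto (@Theta R n) x).
Proof.
rewrite proj_onto_tilt.
by have [] := argmin_exists (ltr0Sn R 1) (@Theta_closed n) (@Theta_0 n)
  (@continuous_sqnorm2 R n) (@sqnorm2_strongly_convex n _) (- (2 *: x)).
Qed.

Lemma proj_Theta_dist n (x s : 'cV[R]_n) : Theta s ->
  sqnorm2 (proj_onto (@Theta R n) x - s) <= 4 * sqnorm2 (x - s).
Proof.
move=> hs; rewrite proj_onto_tilt.
have h t : Theta t -> sqnorm2 s + dot (2 *: s) (t - s) + 2 / 2 * sqnorm2 (t - s) <= sqnorm2 t.
  by move=> _; rewrite /sqnorm2 dotZl !(dotBr, dotBl) (dotC t s); lra.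
have := argmin_dist (ltr0Sn R 1) (@Theta_closed n) (@Theta_0 n)
  (@continuous_sqnorm2 R n) (@sqnorm2_strongly_convex n _) (- (2 *: x)) hs h.
rewrite -scalerBr sqnorm2Z -(sqnorm2N (s - x)) opprB.
set z := argmin_over _ _; set d := sqnorm2 _; lra.
Qed.

Lemma proj_Theta_continuous n : continuous (proj_onto (@Theta R n)).
Proof.
apply: (@lipschitz_continuous _ _ _ 4) => u v; rewrite !proj_onto_tilt.
have := argmin_lipschitz (ltr0Sn R 1) (@Theta_closed n) (@Theta_0 n) (@Theta_mid n)
  (@continuous_sqnorm2 R n) (@sqnorm2_strongly_convex n _) (- (2 *: u)) (- (2 *: v)).
rewrite -opprD -scalerBr sqnorm2N sqnorm2Z.
set d := sqnorm2 _; set e := sqnorm2 _; lra.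
Qed.

Section Loss.
Context n (g : graph n) (y : outcomes g).

Definition loss_gradient (s : 'cV[R]_n) : 'cV[R]_n :=
  \sum_(e : {e | e \in g})
    (slope (dot (design R (val e)) s) - (y e)%:R) *: design R (val e).

Lemma lossbar_tangent s t :
  lossbar y s + dot (loss_gradient s) (t - s) +
    kappa0 R / 2 * dot (t - s) (laplacian R g *m (t - s)) <= lossbar y t.
Proof.
rewrite /lossbar /laplacian dot_sum_rank1 /loss_gradient dot_suml.
have -> (F : edge n -> R) : \sum_(e in g) F e = \sum_(e : {e | e \in g}) F (val e).
  by rewrite big_sub.
rewrite mulr_sumr -!big_split /=; apply: ler_sum => e _; rewrite dotZl.
move: (val e) => u; rewrite [dot _ (t - s)]dotBr.
have := phibar_strong_convex (dot (design R u) s) (dot (design R u) t).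
rewrite expr2; lra.
Qed.

Lemma lossbar_continuous : continuous (@lossbar R n g y).
Proof.
apply: continuous_sumR => e _ x.
have c1 := @continuous_dot R n (design R (val e)) x.
have c2 : {for x, continuous (fun t => phibar (dot (design R (val e)) t))}.
  exact: (continuous_comp c1 (@continuous_phibar R _)).
have c3 : {for x, continuous (fun t => - ((y e)%:R * dot (design R (val e)) t))}.
  by apply: continuousN; apply: continuousM => //; exact: cst_continuous.
exact: (continuousD c3 c2).
Qed.
End Loss.

Lemma lossbar_strongly_convex m (g : graph m.+2) (y : outcomes g) :
  forall s, orth1 s -> forall t, orth1 t ->
  lossbar y s + dot (loss_gradient y s) (t - s) +
    kappa0 R * lambda2 (laplacian R g) / 2 * sqnorm2 (t - s) <= lossbar y t.
Proof.
move=> s os t ot; apply: le_trans (lossbar_tangent y s t); rewrite lerD2l.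
have ots : dot (ones R m.+2) (t - s) = 0 by rewrite dotBr os ot subrr.
have := ler_wpM2l (ltW (kappa0_gt0 R)) (laplacian_form_ge g ots); lra.
Qed.

Section Objective.
Context m (g : graph m.+2) (l0 : 0 < lambda2 (laplacian R g)).
Implicit Types (y : outcomes g) (w s : 'cV[R]_m.+2).

Definition perturbed_min y w := argmin_over (@orth1 R m.+2) (tilt (@lossbar R _ g y) w).

Let mu := kappa0 R * lambda2 (laplacian R g).

Let mu_gt0 : 0 < mu. Proof. by rewrite mulr_gt0 ?kappa0_gt0. Qed.

Lemma lossbar_orth1_convex y : strongly_convex mu (@orth1 R m.+2) (@lossbar R _ g y).
Proof. by move=> s os; exists (loss_gradient y s); exact: lossbar_strongly_convex. Qed.

Lemma perturbed_min_continuous y : continuous (perturbed_min y).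
Proof.
exact: argmin_continuous mu_gt0 (@orth1_closed _) (@orth1_0 _) (@orth1_mid _)
  (@lossbar_continuous _ _ y) (@lossbar_orth1_convex y).
Qed.

Lemma perturbed_min_dist y w s : orth1 s ->
  sqnorm2 (perturbed_min y w - s) <= 4 / mu ^+ 2 * sqnorm2 (loss_gradient y s + w).
Proof.
move=> os.
exact: (argmin_dist mu_gt0 (@orth1_closed _) (@orth1_0 _)
  (@lossbar_continuous _ _ y) (@lossbar_orth1_convex y) w os (lossbar_strongly_convex y os)).
Qed.
End Objective.

Lemma dot_centering n (w u : 'cV[R]_n) : orth1 u ->
  dot (centering R n *m w) u = dot w u.
Proof.
move=> ou; rewrite /centering mulmxBl mul1mx dotBl -scalemxAl dotZl.
by rewrite (dotC (_ *m w)) dot_mulmx_rank1 (dotC u (ones R n)) ou mul0r mulr0 subr0.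
Qed.

(** On the hyperplane orthogonal to the constants the noise and its centering
    define the same linear form. *)
Lemma estimator_good n p (g : graph n) (y : outcomes g) (w : 'cV[R]_n) :
  ~~ (lambda2 (laplacian R g) < expR (- 1) * n%:R * p) ->
  estimator p y w = proj_onto (@Theta R n)
    (argmin_over (@orth1 R n) (tilt (@lossbar R _ g y) w)).
Proof.
move=> /negbTE l; rewrite /estimator l; congr proj_onto.
apply: argmin_over_ext => s t os ot.
by rewrite /tilt !dot_centering.
Qed.

Lemma estimator_Theta n p (g : graph n) (y : outcomes g) (w : 'cV[R]_n) :
  Theta (estimator p y w).
Proof.
rewrite /estimator; case: ifP => _; first exact: Theta_0.
exact: proj_Theta_in.
Qed.

(** 16 = 4 * 4: one factor from projecting on Theta, the other one from the
    minimization. *)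
Lemma estimator_dist m (p t : R) (g : graph m.+2) (y : outcomes g) w s :
  0 < expR (- 1) * m.+2%:R * p ->
  ~~ (lambda2 (laplacian R g) < expR (- 1) * m.+2%:R * p) -> Theta s ->
  sqnorm2 (estimator p y w - s) <=
  16 / (kappa0 R * (expR (- 1) * m.+2%:R * p)) ^+ 2 * sqnorm2 (loss_gradient y s + w).
Proof.
move=> t0 l [s1 os]; rewrite estimator_good//; rewrite -leNgt in l.
have l0 := lt_le_trans t0 l.
apply: le_trans (proj_Theta_dist _ (conj s1 os)) _.
have := perturbed_min_dist l0 y w os; rewrite /perturbed_min.
set a := sqnorm2 _; set b := sqnorm2 _ => h.
have k0 := kappa0_gt0 R.
apply: (@le_trans _ _ (4 * (4 / (kappa0 R * lambda2 (laplacian R g)) ^+ 2 * b))).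
  by rewrite ler_pM2l.
rewrite mulrA; apply: ler_wpM2r; first exact: sqnorm2_ge0.
rewrite mulrA (_ : 4 * 4 = 16) -?natrM// ler_pM2l//.
move: (expR (- 1) * m.+2%:R * p) t0 l => T T0 l.
have kT : 0 < kappa0 R * T by rewrite mulr_gt0.
have kl : 0 < kappa0 R * lambda2 (laplacian R g) by rewrite mulr_gt0.
rewrite lef_pV2 ?posrE ?exprn_gt0//; apply: lerXn2r; rewrite ?nnegrE ?(ltW kT) ?(ltW kl)//.
by rewrite ler_pM2l.
Qed.

Lemma estimator_continuous m (p : R) (g : graph m.+2) (y : outcomes g) :
  0 < expR (- 1) * m.+2%:R * p -> continuous (@estimator R m.+2 p g y).
Proof.
move=> t0; case: (boolP (lambda2 (laplacian R g) < expR (- 1) * m.+2%:R * p)) => l.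
  have -> : estimator p y = cst 0 by apply/funext => w; rewrite /estimator l.
  exact: cst_continuous.
have -> : estimator p y = proj_onto (@Theta R m.+2) \o perturbed_min y.
  by apply/funext => w; rewrite estimator_good.
have l0 : 0 < lambda2 (laplacian R g) by rewrite (lt_le_trans t0)// leNgt.
move=> w; apply: continuous_comp; first exact: perturbed_min_continuous.
exact: proj_Theta_continuous.
Qed.

(** The two losses differ by the linear form (y'_e - y_e) <x_e, s>, which is
    absorbed by the noise. *)
Lemma estimator_shift n (p : R) (g : graph n) (y y' : outcomes g) e (w : 'cV[R]_n) :
  (forall f, f != e -> y f = y' f) ->
  estimator p y w = estimator p y' (w + ((y' e)%:R - (y e)%:R) *: design R (val e)).
Proof.
move=> yy'.
have shift s : orth1 s -> lossbar y s + dot (centering R n *m w) s =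
    lossbar y' s + dot (centering R n *m
      (w + ((y' e)%:R - (y e)%:R) *: design R (val e))) s.
  move=> os; rewrite !dot_centering// dotDl dotZl.
  rewrite /lossbar (bigD1 e)//= [in RHS](bigD1 e)//=.
  under eq_bigr => f fe do rewrite yy'//.
  by move: (\sum_(i | i != e) _) => S; ring.
have same : argmin_over (@orth1 R n)
      (fun s => lossbar y s + dot (centering R n *m w) s) =
    argmin_over (@orth1 R n) (fun s => lossbar y' s + dot (centering R n *m
      (w + ((y' e)%:R - (y e)%:R) *: design R (val e))) s).
  by apply: argmin_over_ext => s t os ot; rewrite !shift.
by rewrite /estimator same.
Qed.
End Estimator.

(** * Borel sets of column vectors *)
Section BorelVec.
Context (R : realType) (n : nat).

(** Open cubes with rational centre and radius 1/(k+1), which form a countable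
    base. *)
Definition rat_box (qk : 'cV[rat]_n * nat) : set 'cV[R]_n :=
  [set v | forall i, `|v i 0 - ratr (qk.1 i 0)| < qk.2.+1%:R^-1].

Lemma open_rat_boxes (U : set 'cV[R]_n) : open U ->
  U = \bigcup_(qk in [set qk | rat_box qk `<=` U]) rat_box qk.
Proof.
move=> oU; apply/seteqP; split; last by move=> v [qk /= h]; exact: h.
move=> v Uv.
have /nbhs_ballP[e /= e0 ve] : nbhs v U by exact: open_nbhs_nbhs.
have e20 : 0 < e / 2 by rewrite divr_gt0.
have [k ke] : exists k : nat, k.+1%:R^-1 < e / 2.
  exists (Num.trunc ((e / 2)^-1)); rewrite invf_plt ?posrE//.
  exact: truncnS_gt.
have k0 : 0 < k.+1%:R^-1 :> R by rewrite invr_gt0.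
have hq i : exists q : rat, `|v i 0 - ratr q| < k.+1%:R^-1.
  have [|q] := @rat_in_itvoo R (v i 0 - k.+1%:R^-1) (v i 0 + k.+1%:R^-1).
    by rewrite ltrD2l (lt_trans _ k0)// oppr_lt0.
  by rewrite in_itv /= => h; exists q; rewrite distrC ltr_distl.
pose q i := xchoose (hq i).
exists (\col_i q i, k) => /=; last first.
  by move=> i /=; rewrite mxE; exact: (xchooseP (hq i)).
move=> u /= hu; apply: ve; rewrite mx_norm_ball /ball_ /=.
apply: (@le_lt_trans _ _ (k.+1%:R^-1 + k.+1%:R^-1)); last first.
  by rewrite [ltRHS](splitr e) ltrD.
apply: norm_le_entries; first by rewrite addr_ge0// ltW.
move=> i; rewrite !mxE -(subrKA (ratr (q i))).
apply: le_trans (ler_normD _ _) _; apply: lerD.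
  by rewrite ltW// (xchooseP (hq i)).
by have := hu i; rewrite mxE distrC => /ltW.
Qed.

Lemma rat_box_sigma (G : set (set 'cV[R]_n)) :
  (forall (q : 'cV[rat]_n) k, <<s G >> (rat_box (q, k))) ->
  forall U, open U -> <<s G >> U.
Proof.
move=> hG U oU; rewrite (open_rat_boxes oU) bigcup_mkcond.
apply: (@countable_bigcupT_measurable _ (g_sigma_algebraType G)) => [|[q k]].
  exact: countableP.
by case: ifP => _; [exact: hG | exact: (@measurable0 _ (g_sigma_algebraType G))].
Qed.

Lemma continuous_measurable_real (f : 'cV[R]_n -> R) : continuous f ->
  measurable_fun setT (f : borel_vec R n -> R).
Proof.
move=> cf; apply: (measurability _ (RGenOpens.measurableE R)).
move=> _ [_ [a [b ->]] <-]; rewrite setTI; apply: sub_sigma_algebra.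
by apply: open_comp => // x _; exact: cf.
Qed.

Lemma measurable_coord i :
  measurable_fun setT (fun v : borel_vec R n => (v : 'cV[R]_n) i 0 : R).
Proof. by apply: continuous_measurable_real; exact: coord_continuous. Qed.

Definition box (A : 'I_n -> set R) : set 'cV[R]_n := [set v | forall i, A i (v i 0)].

Lemma boxE A : box A = \bigcap_(i in setT) ((fun v : 'cV[R]_n => v i 0) @^-1` A i).
Proof. by apply/seteqP; split=> v /= h i => [_|]; exact: h. Qed.

Definition boxes : set (set 'cV[R]_n) :=
  [set box A | A in [set A | forall i, measurable (A i)]].

Lemma boxes_measurable (B : set (borel_vec R n)) : boxes B -> measurable B.
Proof.
move=> [A mA <-]; rewrite boxE; apply: fin_bigcap_measurable; first exact: finite_finset.
by move=> i _; rewrite -[X in measurable X]setTI; exact: measurable_coord.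
Qed.

Lemma boxes_setI : setI_closed boxes.
Proof.
move=> _ _ [A mA <-] [B mB <-]; exists (fun i => A i `&` B i).
  by move=> i; apply: measurableI; [exact: mA | exact: mB].
by apply/seteqP; split=> v /=; [move=> h; split=> i; have [] := h i | move=> [h1 h2] i; split].
Qed.

Lemma boxes_setT : boxes setT.
Proof.
exists (fun=> setT); first by move=> i; exact: measurableT.
by apply/seteqP; split.
Qed.

(** Boxes with measurable sides form a pi-system generating the Borel sets:
    every open set is a countable union of rational cubes. *)
Lemma borel_boxes (B : set (borel_vec R n)) : measurable B -> <<s boxes >> B.
Proof.
apply: smallest_sub; first exact: smallest_sigma_algebra.
apply: rat_box_sigma => q k; apply: sub_sigma_algebra.
exists (fun i => ball (ratr (q i 0) : R) k.+1%:R^-1).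
  by move=> i; exact: measurable_ball.
by apply/seteqP; split=> v /= h i; have := h i; rewrite /ball /= distrC.
Qed.

Lemma measurable_vec d (T : measurableType d) (F : T -> 'cV[R]_n) :
  (forall i, measurable_fun setT (fun t => F t i 0)) ->
  measurable_fun setT (F : T -> borel_vec R n).
Proof.
move=> mF; apply: (@measurability _ _ T (borel_vec R n) setT F boxes).
  apply/seteqP; split; first exact: borel_boxes.
  apply: smallest_sub; first exact: sigma_algebra_measurable.
  by move=> B; exact: boxes_measurable.
move=> _ [_ [A mA <-] <-]; rewrite setTI boxE preimage_bigcap.
apply: fin_bigcap_measurable; first exact: finite_finset.
by move=> i _; rewrite -[X in measurable X]setTI; apply: mF.
Qed.

Lemma continuous_measurable_vec (F : 'cV[R]_n -> 'cV[R]_n) : continuous F ->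
  measurable_fun setT (F : borel_vec R n -> borel_vec R n).
Proof.
move=> cF; apply: (@measurability _ _ (borel_vec R n) (borel_vec R n) setT F (@open 'cV[R]_n)) => // _ [B oB <-].
by rewrite setTI; apply: sub_sigma_algebra; apply: open_comp => // x _; exact: cF.
Qed.
End BorelVec.

(** * Product law of the noise and translation of a coordinate *)
Section ProductLaw.
Context (R : realType) d (Om : measurableType d) (Q : probability Om R).

(** The joint law of independent variables is the product of their laws, by
    uniqueness of the product measure. *)
Lemma independent_joint d1 d2 (T1 : measurableType d1) (T2 : measurableType d2)
    (Y : {mfun Om >-> T1}) (X : {mfun Om >-> T2}) :
  (forall B A, measurable B -> measurable A ->
    Q (Y @^-1` B `&` X @^-1` A) = (Q (Y @^-1` B) * Q (X @^-1` A))%E) ->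
  forall E : set (T1 * T2), measurable E ->
  Q ((fun w => (Y w, X w)) @^-1` E) =
    (\int[distribution Q Y]_y (distribution Q X (xsection E y)))%E.
Proof.
move=> ind E mE.
have mZ : measurable_fun setT (fun w => (Y w, X w)) by apply/measurable_fun_pair; exact: measurable_funP.
pose Z : {mfun Om >-> (T1 * T2)%type} := mfun_Sub (mem_set mZ).
rewrite -[LHS]/(distribution Q Z E).
rewrite -(@product_measure_unique _ _ _ _ _ (distribution Q Y) (distribution Q X))//.
Qed.

Context (n : nat) (W : 'I_n -> {RV Q >-> R}) (Wind : mutually_independent W).

Definition random_vec (w : Om) : 'cV[R]_n := \col_i W i w.

Lemma measurable_random_vec : measurable_fun setT (random_vec : Om -> borel_vec R n).
Proof.
apply: measurable_vec => i.
rewrite (_ : (fun t => _) = W i); last by apply/funext => w; rewrite mxE.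
exact: measurable_funP.
Qed.

(** The vector of the noise variables other than W_i, kept in dimension n by a
    zero in place i, so that W is recovered by adding W_i e_i. *)
Definition zero_coord (i : 'I_n) (w : Om) : 'cV[R]_n := \col_j (if j == i then 0 else W j w).

Lemma measurable_zero_coord i : measurable_fun setT (zero_coord i : Om -> borel_vec R n).
Proof.
apply: measurable_vec => j; case: (eqVneq j i) => ji.
  rewrite (_ : (fun t => _) = cst 0); first exact: measurable_cst.
  by apply/funext => w; rewrite mxE ji eqxx.
rewrite (_ : (fun t => _) = W j); first exact: measurable_funP.
by apply/funext => w; rewrite mxE (negbTE ji).
Qed.

Lemma box_prob (A : 'I_n -> set R) : (forall i, measurable (A i)) ->
  Q [set w | forall i, A i (W i w)] = (\prod_i Q (W i @^-1` A i))%E.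
Proof.
move=> mA; rewrite (eq_bigl (fun i => i \in [set: 'I_n]%SET)) => [|i]; last by rewrite inE.
rewrite -Wind//; congr (Q _); apply/seteqP; split=> w /= h i => [_|]; first exact: h.
by apply: h => /=; rewrite inE.
Qed.

(** The entry i of the vector is the constant 0, so its constraint B i is either
    void or impossible; the other entries are independent of W_i. *)
Lemma zero_coord_box_independent i (A : set R) (B : 'I_n -> set R) :
  measurable A -> (forall j, measurable (B j)) ->
  Q (zero_coord i @^-1` box B `&` W i @^-1` A) =
  (Q (zero_coord i @^-1` box B) * Q (W i @^-1` A))%E.
Proof.
move=> mA mB; have [B0|B0] := pselect (B i 0); last first.
  have -> : zero_coord i @^-1` box B = set0.
    by rewrite -subset0 => w /(_ i); rewrite mxE eqxx.
  by rewrite set0I measure0 mul0e.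
have key C : measurable C -> Q (zero_coord i @^-1` box B `&` W i @^-1` C) =
    (Q (W i @^-1` C) * \prod_(j < n | j != i) Q (W j @^-1` B j))%E.
  move=> mC; pose C' j := if j == i then C else B j.
  have -> : zero_coord i @^-1` box B `&` W i @^-1` C = [set w | forall j, C' j (W j w)].
    apply/seteqP; split=> w /=.
      move=> [hB hC] j; rewrite /C'; case: eqVneq => [->//|ji].
      by have := hB j; rewrite mxE (negbTE ji).
    move=> h; split; last by have := h i; rewrite /C' eqxx.
    move=> j; rewrite mxE; case: eqVneq => [->//|ji].
    by have := h j; rewrite /C' (negbTE ji).
  rewrite box_prob; last by move=> j; rewrite /C'; case: eqVneq.
  rewrite (bigD1 i)//= {1}/C' eqxx; congr (_ * _)%E.
  by apply: eq_bigr => j ji; rewrite /C' (negbTE ji).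
have := key setT measurableT; rewrite preimage_setT setIT probability_setT mul1e => ->.
by rewrite key// muleC.
Qed.

(** From boxes to Borel sets: both sides are finite measures in B which agree on
    the pi-system of boxes. *)
Lemma zero_coord_independent i (B : set (borel_vec R n)) (A : set R) :
  measurable B -> measurable A ->
  Q (zero_coord i @^-1` B `&` W i @^-1` A) = (Q (zero_coord i @^-1` B) * Q (W i @^-1` A))%E.
Proof.
move=> mB mA.
have mXA : measurable (W i @^-1` A) by rewrite -[X in measurable X]setTI; exact: measurable_funP.
have mY := measurable_zero_coord i.
pose Y : {mfun Om >-> borel_vec R n} := mfun_Sub (mem_set mY).
pose m1 := measure_function_pushforward__canonical__measure_function_Measure
  (measure_function_mrestr__canonical__measure_function_Measure Q mXA) mY.
have q0 : 0 <= fine (Q (W i @^-1` A)) by rewrite fine_ge0.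
pose m2 : {measure set (borel_vec R n) -> \bar R} := mscale (NngNum q0) (distribution Q Y).
have qE : (fine (Q (W i @^-1` A)))%:E = Q (W i @^-1` A) by rewrite fineK// fin_num_measure.
have E2 (C : set (borel_vec R n)) : m2 C = (Q (zero_coord i @^-1` C) * Q (W i @^-1` A))%E.
  by rewrite muleC -qE.
rewrite -[LHS]/(m1 B) -E2.
apply: (@g_sigma_algebra_measure_unique _ R (borel_vec R n) (@boxes R n) _ (fun=> setT) _ _ m1 m2).
- by move=> C; exact: boxes_measurable.
- by move=> _; exact: boxes_setT.
- by rewrite bigcup_const//; exists 0%N.
- exact: boxes_setI.
- by move=> _ [C mC <-]; rewrite [RHS]E2 -zero_coord_box_independent.
- move=> _; rewrite -[X in (X < _)%E]/(Q (setT `&` _)); apply: le_lt_trans (ltry 1).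
  by apply: probability_le1; rewrite setTI.
exact: borel_boxes.
Qed.

(** The law of the noise is the product of the law of zero_coord and that of
    W_i; the one-dimensional inequality is integrated over the sections of S. *)
Lemma coordinate_shift i (s : R) (c : \bar R) :
  (forall A : set R, measurable A ->
     (Q [set w | A (W i w + s)%R] <= c * Q (W i @^-1` A))%E) ->
  (0 <= c)%E ->
  forall S : set (borel_vec R n), measurable S ->
  (Q [set w | S (random_vec w + s *: delta_mx i 0)%R] <= c * Q (random_vec @^-1` S))%E.
Proof.
move=> hs c0 S mS.
pose glue (z : borel_vec R n * R) : borel_vec R n := (z.1 : 'cV[R]_n) + z.2 *: delta_mx i 0.
have mglue : measurable_fun setT glue.
  apply: measurable_vec => j.
  rewrite (_ : (fun t => _) = (fun t : borel_vec R n * R =>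
     (t.1 : 'cV[R]_n) j 0 + t.2 * (j == i)%:R)); last first.
    by apply/funext => t; rewrite !mxE andbT.
  apply: measurable_funD.
    by apply: (measurableT_comp (measurable_coord j)); exact: measurable_fst.
  by apply: measurable_funM; [exact: measurable_snd | exact: measurable_cst].
have mE : measurable (glue @^-1` S) by rewrite -[X in measurable X]setTI; exact: mglue.
have mY := measurable_zero_coord i.
pose Y : {mfun Om >-> borel_vec R n} := mfun_Sub (mem_set mY).
have mX : measurable_fun setT (fun w => W i w + s : R) by exact: measurable_funD.
pose X : {mfun Om >-> R} := mfun_Sub (mem_set mX).
have e1 : [set w | S (random_vec w + s *: delta_mx i 0)] =
    (fun w => (Y w, X w)) @^-1` (glue @^-1` S).
  apply/seteqP; split=> w /=; rewrite /glue /= (_ : zero_coord i w + _ = random_vec w + s *: delta_mx i 0)//;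
  apply/colP => j; rewrite !mxE andbT; case: eqVneq => [->|]; rewrite ?mulr1 ?mulr0 ?add0r ?addr0//.
have e2 : random_vec @^-1` S = (fun w => (Y w, W i w)) @^-1` (glue @^-1` S).
  apply/seteqP; split=> w /=; rewrite /glue /= (_ : zero_coord i w + _ = random_vec w)//;
  apply/colP => j; rewrite !mxE andbT; case: eqVneq => [->|]; rewrite ?mulr1 ?mulr0 ?add0r ?addr0//.
rewrite e1 e2 independent_joint//; last first.
  move=> B A mB mA.
  have mA' : measurable ((fun x => x + s) @^-1` A).
    by rewrite -[X in measurable X]setTI; apply: measurable_funD.
  exact: (zero_coord_independent i mB mA').
rewrite independent_joint//; last first.
  by move=> B A mB mA; exact: zero_coord_independent.
rewrite -ge0_integralZl//; last exact: measurable_fun_xsection.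
apply: ge0_le_integral => //.
- exact: measurable_fun_xsection.
- by apply: measurable_funeM; exact: measurable_fun_xsection.
move=> y _; apply: hs; exact: measurable_xsection.
Qed.
End ProductLaw.

(** * Laplace distribution *)
Section Density.
Context (R : realType).
Local Notation mu := (@lebesgue_measure R).

(** The density is almost everywhere the Radon-Nikodym derivative. *)
Lemma integral_density (nu : probability (measurableTypeR R) R) (f : R -> R) (g : R -> \bar R) :
  measurable_fun setT f -> (forall x, 0 <= f x) ->
  (forall A, measurable A -> nu A = (\int[mu]_(x in A) (f x)%:E)%E) ->
  measurable_fun setT g -> (forall x, 0 <= g x)%E ->
  (\int[nu]_x g x = \int[mu]_x (g x * (f x)%:E))%E.
Proof.
move=> mf f0 nuE mg g0.
have mfE : measurable_fun setT (fun x => (f x)%:E) by exact/measurable_EFinP.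
have dom : nu `<< mu.
  apply/null_content_dominatesP => A mA muA0; rewrite nuE//.
  by apply: null_set_integral => //; exact: measurable_funTS.
rewrite -(@Radon_Nikodym_SigmaFinite.change_of_variables _ _ _ nu mu dom g setT g0 measurableT mg).
have h := @Radon_Nikodym_SigmaFinite.f_integrable _ _ _ nu mu dom.
have mh : measurable_fun setT (Radon_Nikodym_SigmaFinite.f nu mu) by exact: measurable_int h.
apply: ae_eq_integral => //.
- exact: emeasurable_funM.
- exact: emeasurable_funM.
apply: ae_eqe_mul2l; apply: integral_ae_eq => // E _ mE.
by rewrite -nuE// -Radon_Nikodym_SigmaFinite.f_integral.
Qed.

Lemma lebesgue_shift (s : R) (A : set R) : measurable A ->
  mu ((fun x => x + s) @^-1` A) = mu A.
Proof.
move=> mA.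
have ms' : measurable_fun setT (fun x : R => x + s : R) by exact: measurable_funD.
have ms : @measurable_fun _ _ (measurableTypeR R) (measurableTypeR R) setT (fun x : R => x + s) by exact: ms'.
pose nu : measure (measurableTypeR R) R :=
  measure_function_pushforward__canonical__measure_function_Measure mu ms.
rewrite -[LHS]/(nu A); apply/esym.
apply: (@lebesgue_measure_unique R nu) => // X [[a b] _ <-].
rewrite -[RHS]/(mu ((fun x => x + s) @^-1` `]a, b]%classic)).
have -> : (fun x => x + s) @^-1` `]a, b]%classic = `](a - s), (b - s)]%classic.
  by apply/seteqP; split=> x /=; rewrite !in_itv /= ltrBlDr lerBrDr.
rewrite !lebesgue_measure_itv /= !lte_fin ltrD2r; case: ifP => // _.
by rewrite -!EFinB; congr _%:E; ring.
Qed.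

Context (eps : R) (eps0 : 0 < eps).

Lemma measurable_laplace_pdf e : measurable_fun setT (@laplace_pdf R e).
Proof.
apply: measurable_funM; first exact: measurable_cst.
apply: (measurableT_comp (@measurable_expR R)); apply: measurableT_comp => //.
apply: measurable_funM; last exact: measurable_cst.
apply: measurable_funM; first exact: measurable_cst.
by apply: continuous_measurable_fun => x; exact: norm_continuous.
Qed.

Lemma laplace_pdf_ge0 x : 0 <= laplace_pdf eps x.
Proof. by rewrite /laplace_pdf mulr_ge0 ?expR_ge0// divr_ge0 ?ltW. Qed.

Lemma laplace_pdf_shift x s :
  laplace_pdf eps (x - s) <= expR (eps * `|s| / 2) * laplace_pdf eps x.
Proof.
rewrite /laplace_pdf mulrCA; apply: ler_wpM2l; first by rewrite divr_ge0 ?ltW.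
rewrite -expRD ler_expR.
have h : `|x| <= `|x - s| + `|s| by rewrite -[X in `|X| <= _](subrK s x) ler_normD.
have := ler_wpM2l (ltW eps0) h; lra.
Qed.

Context d (Om : measurableType d) (Q : probability Om R) (X : {RV Q >-> R}).
Hypothesis Xdens : has_density X (laplace_pdf eps).

(** By translation invariance of the Lebesgue measure X + s has the density
    x |-> laplace_pdf eps (x - s), and |x - s| >= |x| - |s|. *)
Lemma laplace_shift (s : R) (A : set R) : measurable A ->
  (Q [set w | A (X w + s)%R] <= (expR (eps * `|s| / 2))%:E * Q (X @^-1` A))%E.
Proof.
move=> mA; pose A' := (fun x => x + s) @^-1` A.
have ms : measurable_fun setT (fun x : R => x + s : R) by exact: measurable_funD.
have ms' : @measurable_fun _ _ (measurableTypeR R) (measurableTypeR R) setT (fun x : R => x + s) by exact: ms.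
have mA' : measurable A' by rewrite -[X in measurable X]setTI; exact: ms.
have mf := measurable_laplace_pdf eps.
have mfs : measurable_fun setT (fun x : R => (laplace_pdf eps (x - s))%:E).
  apply/measurable_EFinP; apply: (measurableT_comp mf).
  by apply: measurable_funB => //; exact: measurable_cst.
rewrite -[Q [set w | _]]/(distribution Q X A') -[Q (X @^-1` A)]/(distribution Q X A).
rewrite !Xdens//.
have -> : (\int[mu]_(x in A') (laplace_pdf eps x)%:E =
    \int[mu]_(x in A) (laplace_pdf eps (x - s))%:E)%E.
  pose nu : measure (measurableTypeR R) R :=
    measure_function_pushforward__canonical__measure_function_Measure mu ms'.
  transitivity (\int[nu]_(x in A) (laplace_pdf eps (x - s))%:E)%E.
    rewrite (ge0_integral_pushforward ms')//.
    - by apply: eq_integral => x _ /=; rewrite addrK.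
    - exact: measurable_funTS.
    - by move=> y _; rewrite lee_fin laplace_pdf_ge0.
  apply: eq_measure_integral => B mB _.
  exact: lebesgue_shift.
rewrite -ge0_integralZl//.
- apply: ge0_le_integral => //.
  + by move=> x _; rewrite lee_fin laplace_pdf_ge0.
  + exact: measurable_funTS.
  + by apply/measurable_funTS/measurable_funeM/measurable_EFinP.
  by move=> x _; rewrite lee_fin laplace_pdf_shift.
- exact/measurable_funTS/measurable_EFinP.
- by move=> x _; rewrite lee_fin laplace_pdf_ge0.
Qed.

(** The density is even, and on the half line it is half the exponential density
    of rate e/2. *)
Lemma laplace_pdf_integral e : 0 < e -> (\int[mu]_x (laplace_pdf e x)%:E <= 1)%E.
Proof.
move=> e0.
have ge0 x : 0 <= laplace_pdf e x.
  by rewrite /laplace_pdf mulr_ge0 ?expR_ge0// divr_ge0 ?ltW.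
rewrite ge0_symfun_integralT//; last 2 first.
- move=> x.
  have c1 : {for x, continuous (fun y : R => e * `|y|)}.
    by apply: continuousM; [exact: cst_continuous | exact: norm_continuous].
  have c2 : {for x, continuous (fun y : R => - (e * `|y| / 2))}.
    by apply: continuousN; apply: continuousM => //; exact: cst_continuous.
  have c3 : {for x, continuous (fun y : R => expR (- (e * `|y| / 2)))}.
    exact: (continuous_comp c2 (@continuous_expR R _)).
  have c4 : {for x, continuous (fun y : R => e / 4 * expR (- (e * `|y| / 2)))}.
    by apply: continuousM => //; exact: cst_continuous.
  exact: c4.
- by move=> x /=; rewrite /laplace_pdf normrN.
have e20 : 0 < e / 2 by rewrite divr_gt0.
pose P := [set x : R | 0 <= x]; rewrite -/P.
have -> : (\int[mu]_(x in P) (laplace_pdf e x)%:E =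
   \int[mu]_(x in P) (2^-1%:E * (exponential_pdf (e / 2) x)%:E))%E.
  apply: eq_integral => x; rewrite inE /= => x0.
  rewrite exponential_pdfE// -EFinM; congr _%:E.
  rewrite /laplace_pdf ger0_norm//.
  rewrite (_ : - (e * x / 2) = - (e / 2) * x); last by field.
  by field.
have mx : measurable_fun setT (fun x : R => (exponential_pdf (e / 2) x)%:E).
  by apply/measurable_EFinP; exact: measurable_exponential_pdf.
have x0 x : (0 <= (exponential_pdf (e / 2) x)%:E)%E.
  by rewrite lee_fin exponential_pdf_ge0// ltW.
have mP : measurable (P : set (measurableTypeR R)).
  rewrite (_ : P = `[0, +oo[%classic); first exact: measurable_itv.
  by apply/seteqP; split=> x /=; rewrite in_itv /= andbT.
rewrite ge0_integralZl//; last exact: measurable_funTS.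
rewrite muleA -EFinM mulfV// mul1e -(integral_exponential_pdf e20).
by apply: ge0_subset_integral.
Qed.

(** The factor x^2 is absorbed into half of the exponential decay: with
    u = eps |x| / 4 one has u^2 / 2 <= e^u, hence
    x^2 laplace_pdf eps x <= 64 / eps^2 laplace_pdf (eps / 2) x. *)
Lemma laplace_second_moment :
  (\int[Q]_w ((X w) ^+ 2)%:E <= (64 / eps ^+ 2)%:E)%E.
Proof.
have msq : measurable_fun setT (fun x : R => (x ^+ 2)%:E).
  by apply/measurable_EFinP; exact: measurable_funX.
have mX : @measurable_fun _ _ Om (measurableTypeR R) setT X.
  exact: (measurable_funP X).
pose X' : {mfun Om >-> measurableTypeR R} :=
  @mfun_Sub _ _ Om (measurableTypeR R) X (mem_set mX).
have -> : (\int[Q]_w ((X w) ^+ 2)%:E = \int[distribution Q X']_x (x ^+ 2)%:E)%E.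
  by rewrite (@ge0_integral_distribution _ _ _ _ _ Q X' (fun x => (x ^+ 2)%:E))//
    => x; rewrite lee_fin sqr_ge0.
rewrite (@integral_density (distribution Q X') (laplace_pdf eps))//; first last.
- by move=> x; rewrite lee_fin sqr_ge0.
- exact: laplace_pdf_ge0.
- exact: measurable_laplace_pdf.
have c0 : 0 <= 64 / eps ^+ 2 by rewrite divr_ge0// sqr_ge0.
have bound x : x ^+ 2 * laplace_pdf eps x <= 64 / eps ^+ 2 * laplace_pdf (eps / 2) x.
  pose u := eps * `|x| / 4.
  have u0 : 0 <= u by rewrite /u divr_ge0// mulr_ge0// ltW.
  have h := @expR_ge1Dxn R u 1 u0.
  have -> : x ^+ 2 = 16 / eps ^+ 2 * u ^+ 2.
    rewrite -real_normK ?num_real// /u; field; exact: lt0r_neq0.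
  have -> : laplace_pdf eps x = 2 * laplace_pdf (eps / 2) x * expR (- u).
    rewrite /laplace_pdf -[in RHS]mulrA -[X in 2 * X]mulrA -expRD mulrA.
    by congr (_ * expR _); [field | rewrite /u; field].
  have -> : 16 / eps ^+ 2 * u ^+ 2 * (2 * laplace_pdf (eps / 2) x * expR (- u)) =
    64 / eps ^+ 2 * laplace_pdf (eps / 2) x * (u ^+ 2 / 2 * expR (- u)).
    by field; exact: lt0r_neq0.
  rewrite -[leRHS]mulr1; apply: ler_wpM2l.
    by rewrite mulr_ge0// /laplace_pdf mulr_ge0 ?expR_ge0// !divr_ge0// ltW.
  rewrite expRN ler_pdivrMr ?expR_gt0// mul1r; apply: le_trans h.
  by rewrite -[leLHS]add0r lerD.
apply: (@le_trans _ _ (\int[mu]_x ((64 / eps ^+ 2)%:E * (laplace_pdf (eps / 2) x)%:E))%E).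
  apply: ge0_le_integral => //.
  - by move=> x _; rewrite -EFinM lee_fin mulr_ge0 ?sqr_ge0 ?laplace_pdf_ge0.
  - by apply: emeasurable_funM => //; apply/measurable_EFinP; exact: measurable_laplace_pdf.
  - by apply: measurable_funeM; apply/measurable_EFinP; exact: measurable_laplace_pdf.
  by move=> x _; rewrite -!EFinM lee_fin.
have e20 : 0 < eps / 2 by rewrite divr_gt0.
rewrite ge0_integralZl//; first last.
- by move=> x _; rewrite lee_fin /laplace_pdf mulr_ge0 ?expR_ge0// !divr_ge0// ltW.
- by apply/measurable_EFinP; exact: measurable_laplace_pdf.
by rewrite -[leRHS]mule1; apply: lee_wpmul2l => //; exact: laplace_pdf_integral.
Qed.
End Density.

(** * Privacy *)
Section Privacy.
Context (R : realType).

Lemma measurable_translation n (u : 'cV[R]_n) :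
  measurable_fun setT ((fun v : 'cV[R]_n => v + u) : borel_vec R n -> borel_vec R n).
Proof.
apply: measurable_vec => i.
rewrite (_ : (fun t => _) = (fun v : borel_vec R n => (v : 'cV[R]_n) i 0 + u i 0)).
  by apply: measurable_funD; [exact: measurable_coord | exact: measurable_cst].
by apply/funext => v; rewrite mxE.
Qed.

Context d (Om : measurableType d) (Q : probability Om R).
Context n (W : 'I_n -> {RV Q >-> R}) (Wind : mutually_independent W).
Context (eps : R) (eps0 : 0 < eps).
Hypothesis Wdens : forall i, has_density (W i) (laplace_pdf eps).

(** Two coordinates are moved by one unit each, at the price of a factor
    e^{eps/2} each. *)
Lemma design_shift_le (e : edge n) (c : R) : `|c| = 1 ->
  forall S : set (borel_vec R n), measurable S ->
  (Q [set w | S (random_vec W w + c *: design R e)%R] <=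
   (expR eps)%:E * Q (random_vec W @^-1` S))%E.
Proof.
move=> c1 S mS.
have one i s : `|s| = 1 -> forall S : set (borel_vec R n), measurable S ->
    (Q [set w | S (random_vec W w + s *: delta_mx i 0)%R] <=
      (expR (eps / 2))%:E * Q (random_vec W @^-1` S))%E.
  move=> s1; apply: coordinate_shift => // A mA.
  by have := laplace_shift eps0 (Wdens i) s mA; rewrite s1 mulr1.
pose S1 : set (borel_vec R n) := (fun v => v + (- c) *: delta_mx (val e).2 0) @^-1` S.
have mS1 : measurable S1.
  by rewrite -[X in measurable X]setTI; exact: measurable_translation.
rewrite (_ : [set w | _] = [set w | S1 (random_vec W w + c *: delta_mx (val e).1 0)]); last first.
  apply/seteqP; split=> w; rewrite /S1 /=; congr S;
  by rewrite /design scalerBr scaleNr addrA.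
apply: le_trans (one _ _ c1 _ mS1) _.
have c1' : `|- c| = 1 by rewrite normrN.
rewrite [in leRHS](splitr eps) expRD EFinM -muleA; apply: lee_wpmul2l.
  by rewrite lee_fin expR_ge0.
exact: one.
Qed.

End Privacy.

Section PrivateMechanism.
Context (R : realType) d (Om : measurableType d) (Q : probability Om R).
Context m (W : 'I_m.+2 -> {RV Q >-> R}) (Wind : mutually_independent W).
Context (p eps : R) (p0 : 0 < p) (eps0 : 0 < eps).
Hypothesis Wdens : forall i, has_density (W i) (laplace_pdf eps).

Let T0 : 0 < expR (- 1) * m.+2%:R * p :> R.
Proof. by rewrite !mulr_gt0 ?expR_gt0. Qed.

Lemma measurable_estimator (g : graph m.+2) (y : outcomes g) :
  measurable_fun setT (estimator p y : borel_vec R m.+2 -> borel_vec R m.+2).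
Proof. by apply: continuous_measurable_vec; exact: estimator_continuous. Qed.

Lemma measurable_mechanism (g : graph m.+2) (y : outcomes g) :
  measurable_fun setT (btl_mechanism p W y : Om -> borel_vec R m.+2).
Proof.
by apply: (measurableT_comp (measurable_estimator y)); exact: measurable_random_vec.
Qed.

Lemma estimator_private : edge_level_dp Q eps 0 (btl_mechanism p W).
Proof.
split; first exact: measurable_mechanism.
move=> g y y' [e [ye yf]] S mS; rewrite adde0.
pose S' : set (borel_vec R m.+2) := estimator p y' @^-1` S.
have mS' : measurable S'.
  by rewrite -[X in measurable X]setTI; exact: measurable_estimator.
have c1 : `|(y' e)%:R - (y e)%:R| = 1 :> R.
  by case: (y e) (y' e) ye => -[] //= _; rewrite ?subr0 ?sub0r ?normrN normr1.
pose c : R := (y' e)%:R - (y e)%:R.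
have est w : btl_mechanism p W y w = estimator p y' (random_vec W w + c *: design R (val e)).
  exact: (estimator_shift p (random_vec W w) yf).
have e1 : btl_mechanism p W y @^-1` S =
    [set w | S' (random_vec W w + c *: design R (val e))].
  apply/funext => w.
  change (S (btl_mechanism p W y w) =
    S (estimator p y' (random_vec W w + c *: design R (val e)))).
  by rewrite est.
have e2 : btl_mechanism p W y' @^-1` S = random_vec W @^-1` S'.
  apply/funext => w.
  change (S (estimator p y' (random_vec W w)) = S (estimator p y' (random_vec W w))).
  reflexivity.
(* The two events enter only through their descriptions e1 and e2. *)
have key A B : A = [set w | S' (random_vec W w + c *: design R (val e))] ->
    B = random_vec W @^-1` S' -> (Q A <= (expR eps)%:E * Q B)%E.
  by move=> -> ->; exact: (design_shift_le Wind eps0 Wdens (val e) c1 mS').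
exact: key e1 e2.
Qed.
End PrivateMechanism.

(** * Mean square of the gradient *)
Section OutcomeVariance.
Context (R : realType) (I : finType) (q : I -> R).

Definition bits_pmf (y : {ffun I -> bool}) := \prod_i bernoulli_pmf (q i) (y i).

Lemma bits_pmf_sum1 : \sum_y bits_pmf y = 1.
Proof.
rewrite /bits_pmf -(bigA_distr_bigA (fun i b => bernoulli_pmf (q i) b)).
by rewrite big1// => i _; rewrite big_bool /bernoulli_pmf /= addrC subrK.
Qed.

Lemma bits_covariance i j :
  \sum_y bits_pmf y * ((q i - (y i)%:R) * (q j - (y j)%:R)) =
  if i == j then q i * (1 - q i) else 0.
Proof.
pose F k (b : bool) := bernoulli_pmf (q k) b *
  ((if k == i then q k - b%:R else 1) * (if k == j then q k - b%:R else 1)).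
have one (c : I -> R) l : \prod_k (if k == l then c k else 1) = c l.
  by rewrite -big_mkcond big_pred1_eq.
transitivity (\sum_(y : {ffun I -> bool}) \prod_k F k (y k)).
  apply: eq_bigr => y _; rewrite /F !big_split /=.
  by rewrite (one (fun k => q k - (y k)%:R)) (one (fun k => q k - (y k)%:R)).
rewrite -bigA_distr_bigA; case: eqVneq => [eij|ij].
  subst j.
  rewrite (bigD1 i)//= [X in _ * X]big1 ?mulr1.
    by rewrite big_bool /F eqxx /bernoulli_pmf /=; ring.
  move=> k ki; rewrite big_bool /F (negbTE ki) /bernoulli_pmf /=; ring.
have F0 : \sum_b F i b = 0.
  by rewrite big_bool /F eqxx (negbTE ij) /bernoulli_pmf /=; ring.
by rewrite (bigD1 i)//= F0 mul0r.
Qed.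

(** The cross terms vanish since distinct bits are uncorrelated. *)
Lemma bits_variance n (x : I -> 'cV[R]_n) :
  \sum_y bits_pmf y * sqnorm2 (\sum_i (q i - (y i)%:R) *: x i) =
  \sum_i q i * (1 - q i) * sqnorm2 (x i).
Proof.
transitivity (\sum_y \sum_i \sum_j
   bits_pmf y * ((q i - (y i)%:R) * (q j - (y j)%:R)) * dot (x i) (x j)).
  apply: eq_bigr => y _; rewrite /sqnorm2 dot_suml mulr_sumr; apply: eq_bigr => i _.
  rewrite dot_sumr mulr_sumr; apply: eq_bigr => j _.
  by rewrite dotZl dotZr; ring.
rewrite exchange_big /=; apply: eq_bigr => i _.
rewrite exchange_big /= (bigD1 i)//= [X in _ + X]big1 ?addr0.
  by rewrite -mulr_suml bits_covariance eqxx.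
by move=> j ji; rewrite -mulr_suml bits_covariance eq_sym (negbTE ji) mul0r.
Qed.
End OutcomeVariance.

Section Gradient.
Context (R : realType) (n : nat).

Lemma btl_prob_sigma (theta : 'cV[R]_n) (e : edge n) :
  btl_prob theta e = sigma (dot (design R e) theta).
Proof.
rewrite /btl_prob /sigma dot_design; move: (theta _ 0) (theta _ 0) => a b.
rewrite expRB; have a0 := expR_gt0 a; have b0 := expR_gt0 b.
by field; rewrite !gt_eqF ?addr_gt0 ?divr_gt0.
Qed.

Lemma Theta_dot_design (theta : 'cV[R]_n) (e : edge n) : Theta theta ->
  - 2 <= dot (design R e) theta <= 2.
Proof.
move=> [t1 _]; rewrite -ler_norml dot_design; apply: le_trans (ler_normB _ _) _.
by have := lerD (le_trans (entry_le_norm theta (val e).1) t1)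
  (le_trans (entry_le_norm theta (val e).2) t1); lra.
Qed.

Lemma outcome_pmf_bits (theta : 'cV[R]_n) (g : graph n) (y : outcomes g) :
  outcome_pmf theta y = bits_pmf (fun e : {e | e \in g} => btl_prob theta (val e)) y.
Proof. by []. Qed.

Lemma btl_prob01 (theta : 'cV[R]_n) (e : edge n) : 0 <= btl_prob theta e <= 1.
Proof. by rewrite btl_prob_sigma !ltW ?sigma_gt0 ?sigma_lt1. Qed.

Lemma outcome_pmf_ge0 (theta : 'cV[R]_n) (g : graph n) (y : outcomes g) :
  0 <= outcome_pmf theta y.
Proof.
by apply: prodr_ge0 => e _; apply: bernoulli_pmf_ge0; exact: btl_prob01.
Qed.

(** At the true parameter each <x_e, theta> lies in [-2, 2], where the slope of
    phibar is the logistic function, that is, the success probability.  So the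
    gradient is a sum of independent centred terms, each of mean square
    2 q (1 - q) <= 1. *)
Lemma gradient_mean_square (theta : 'cV[R]_n) (g : graph n) : Theta theta ->
  \sum_(y : outcomes g) outcome_pmf theta y * sqnorm2 (loss_gradient y theta) <= #|g|%:R.
Proof.
move=> ht; pose q (e : {e | e \in g}) := btl_prob theta (val e).
have e1 (y : outcomes g) : loss_gradient y theta =
    \sum_(e : {e | e \in g}) (q e - (y e)%:R) *: design R (val e).
  apply: eq_bigr => e _; congr ((_ - _) *: _).
  by rewrite slope_in ?Theta_dot_design// /q btl_prob_sigma.
rewrite (eq_bigr (fun y => bits_pmf q y *
   sqnorm2 (\sum_e (q e - (y e)%:R) *: design R (val e)))); last first.
  by move=> y _; rewrite outcome_pmf_bits e1.
rewrite bits_variance; apply: (@le_trans _ _ (\sum_(e : {e | e \in g}) 1)).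
  apply: ler_sum => e _; rewrite sqnorm2_design.
  have := sqr_ge0 (2 * q e - 1); rewrite expr2; lra.
by rewrite sumr_const card_sig.
Qed.

Lemma Theta_sqdist (u v : 'cV[R]_n) : Theta u -> Theta v -> sqnorm2 (u - v) <= 4 * n%:R.
Proof.
move=> [u1 _] [v1 _]; apply: le_trans (sqnorm2_le_norm _) _.
rewrite [leRHS]mulrC; apply: ler_wpM2l => //.
have h : `|u - v| <= 2 by apply: le_trans (ler_normB _ _) _; lra.
rewrite (_ : 4 = 2 ^+ 2); last by rewrite expr2; ring.
by apply: lerXn2r; rewrite ?nnegrE.
Qed.
End Gradient.

(** * Risk *)
Lemma card_edge_le n : (#|{: edge n}| <= n * n)%N.
Proof. by rewrite card_sig (leq_trans (max_card _))// card_prod card_ord. Qed.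

Section Risk.
Context (R : realType) d (Om : measurableType d) (Q : probability Om R).
Context m (W : 'I_m.+2 -> {RV Q >-> R}).
Context (p eps : R) (p0 : 0 < p) (p1 : p <= 1) (eps0 : 0 < eps).
Hypothesis Wdens : forall i, has_density (W i) (laplace_pdf eps).
Context (theta : 'cV[R]_m.+2) (ht : Theta theta).

Lemma risk_le (b : forall g : graph m.+2, outcomes g -> R) (M : mechanism R m.+2 Om) :
  (forall g y, ('E_Q[fun w => sqnorm2 (M g y w - theta)] <= (b g y)%:E)%E) ->
  (risk Q p theta M <=
   (\sum_(g : graph m.+2) graph_pmf p g *
      \sum_(y : outcomes g) outcome_pmf theta y * b g y)%:E)%E.
Proof.
move=> hb; rewrite /risk -sumEFin; apply: lee_sum => g _.
rewrite EFinM; apply: lee_wpmul2l.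
  by rewrite lee_fin; apply: subset_pmf_ge0; rewrite p1 ltW.
rewrite -sumEFin; apply: lee_sum => y _.
by rewrite EFinM; apply: lee_wpmul2l => //; rewrite lee_fin outcome_pmf_ge0.
Qed.

Let measurable_error (g : graph m.+2) (y : outcomes g) :
  measurable_fun setT (fun w => (sqnorm2 (btl_mechanism p W y w - theta))%:E).
Proof.
apply/measurable_EFinP.
have ms : measurable_fun setT
    ((fun v : 'cV[R]_m.+2 => sqnorm2 (v + - theta)) : borel_vec R m.+2 -> R).
  apply: (measurableT_comp (continuous_measurable_real (@continuous_sqnorm2 R m.+2))).
  exact: measurable_translation.
exact: (measurableT_comp ms (measurable_mechanism W p0 y)).
Qed.

Lemma expected_error_trivial (g : graph m.+2) (y : outcomes g) :
  ('E_Q[fun w => sqnorm2 (btl_mechanism p W y w - theta)] <= (4 * m.+2%:R)%:E)%E.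
Proof.
rewrite unlock.
apply: (@le_trans _ _ (\int[Q]_w (cst (4 * m.+2%:R)%:E) w)%E); last first.
  rewrite integral_cst// [X in (_ * X <= _)%E](_ : _ = 1%E) ?mule1//.
  exact: (@probability_setT _ _ _ Q).
apply: ge0_le_integral => //.
- by move=> w _; rewrite lee_fin sqnorm2_ge0.
by move=> w _; rewrite lee_fin Theta_sqdist//; exact: estimator_Theta.
Qed.

Let T := expR (- 1) * m.+2%:R * p.
Let T0 : 0 < T. Proof. by rewrite !mulr_gt0 ?expR_gt0. Qed.
Let c := 16 / (kappa0 R * T) ^+ 2.
Let c0 : 0 <= c. Proof. by rewrite divr_ge0// sqr_ge0. Qed.

(** The mean square of the noise is at most 64 / eps^2 per coordinate. *)
Lemma expected_error_good (g : graph m.+2) (y : outcomes g) :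
  ~~ (lambda2 (laplacian R g) < T) ->
  ('E_Q[fun w => sqnorm2 (btl_mechanism p W y w - theta)] <=
   (2 * c * (sqnorm2 (loss_gradient y theta) + m.+2%:R * (64 / eps ^+ 2)))%:E)%E.
Proof.
move=> l; rewrite unlock.
set G := sqnorm2 (loss_gradient y theta).
have mW i : measurable_fun setT (fun w => ((W i w) ^+ 2)%:E).
  by apply/measurable_EFinP; apply: measurable_funX; exact: measurable_funP.
have W0 i w : (0 <= ((W i w) ^+ 2)%:E)%E by rewrite lee_fin sqr_ge0.
have G0 : 0 <= G by exact: sqnorm2_ge0.
have c20 : 0 <= 2 * c by rewrite mulr_ge0.
apply: (@le_trans _ _ (\int[Q]_w ((2 * c)%:E *
    (G%:E + \sum_(i < m.+2) ((W i w) ^+ 2)%:E)))%E).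
  apply: ge0_le_integral => //.
  - by move=> w _; rewrite lee_fin sqnorm2_ge0.
  - apply: measurable_funeM; apply: emeasurable_funD; first exact: measurable_cst.
    by apply: emeasurable_sum.
  move=> w _; rewrite sumEFin -EFinD -EFinM lee_fin.
  have h : sqnorm2 (btl_mechanism p W y w - theta) <=
      c * sqnorm2 (loss_gradient y theta + \col_i W i w).
    exact: (estimator_dist T y (\col_i W i w) T0 l ht).
  apply: (le_trans h); rewrite (mulrC 2 c) -(mulrA c); apply: ler_wpM2l => //.
  apply: le_trans (sqnorm2D_le _ _) _; rewrite -mulrDr ler_pM2l// lerD2l.
  by rewrite sqnorm2E; apply: ler_sum => i _; rewrite mxE.
have mS : measurable_fun setT (fun w => (\sum_(i < m.+2) ((W i w) ^+ 2)%:E)%E).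
  by apply: emeasurable_sum.
have S0 w : (0 <= \sum_(i < m.+2) ((W i w) ^+ 2)%:E)%E by apply: sume_ge0.
rewrite ge0_integralZl//; last 2 first.
- by apply: emeasurable_funD => //; exact: measurable_cst.
- by move=> w _; rewrite adde_ge0// lee_fin.
rewrite [leRHS]EFinM; apply: lee_wpmul2l; first by rewrite lee_fin.
rewrite ge0_integralD//.
rewrite integral_cst// [X in (_ * X + _ <= _)%E](_ : _ = 1%E) ?mule1; last first.
  exact: (@probability_setT _ _ _ Q).
rewrite EFinD; apply: leeD => //.
rewrite ge0_integral_sum//.
apply: (@le_trans _ _ (\sum_(i < m.+2) (64 / eps ^+ 2)%:E)%E).
  by apply: lee_sum => i _; exact: laplace_second_moment.
by rewrite sumEFin lee_fin sumr_const card_ord -[leLHS]mulr_natl.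
Qed.

Lemma risk_bound_trivial :
  (risk Q p theta (btl_mechanism p W) <= (4 * m.+2%:R)%:E)%E.
Proof.
apply: le_trans (risk_le (b := fun _ _ => 4 * m.+2%:R) _) _.
  exact: expected_error_trivial.
rewrite lee_fin.
under eq_bigr => g _.
  rewrite -mulr_suml (_ : \sum_y _ = 1) ?mul1r; last first.
    exact: (bits_pmf_sum1 (fun e : {e | e \in g} => btl_prob theta (val e))).
  over.
by rewrite -mulr_suml (_ : \sum_g _ = 1) ?mul1r//; exact: subset_pmf_sum1.
Qed.

(** The diameter bound on the graphs with small lambda2, the strong convexity
    bound on the others; the mean number of edges is at most p n^2. *)
Lemma risk_bound_good :
  (risk Q p theta (btl_mechanism p W) <=
   (4 * m.+2%:R * (\sum_(g : graph m.+2 | lambda2 (laplacian R g) < T) graph_pmf p g) +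
    2 * c * (p * (m.+2%:R * m.+2%:R) + m.+2%:R * (64 / eps ^+ 2)))%:E)%E.
Proof.
pose V := m.+2%:R * (64 / eps ^+ 2) : R.
have V0 : 0 <= V by rewrite mulr_ge0// divr_ge0// sqr_ge0.
(* The sum of the two bounds dominates the applicable one and is easier to
   average than a case distinction. *)
pose b (g : graph m.+2) (y : outcomes g) :=
  4 * m.+2%:R * (lambda2 (laplacian R g) < T)%R%:R +
  2 * c * (sqnorm2 (loss_gradient y theta) + V).
have c20 : 0 <= 2 * c by rewrite mulr_ge0.
have nonneg (g : graph m.+2) (y : outcomes g) :
    0 <= 2 * c * (sqnorm2 (loss_gradient y theta) + V).
  by rewrite mulr_ge0// addr_ge0// sqnorm2_ge0.
apply: le_trans (risk_le (b := b) _) _.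
  move=> g y; rewrite /b; case: (boolP (lambda2 (laplacian R g) < T)) => l.
    apply: le_trans (expected_error_trivial y) _.
    by rewrite lee_fin mulr1 lerDl nonneg.
  by rewrite mulr0 add0r; exact: expected_error_good.
rewrite lee_fin /b.
apply: (@le_trans _ _ (\sum_(g : graph m.+2) graph_pmf p g *
    (4 * m.+2%:R * (lambda2 (laplacian R g) < T)%R%:R + 2 * c * (#|g|%:R + V)))).
  apply: ler_sum => g _; apply: ler_wpM2l.
    by apply: subset_pmf_ge0; rewrite p1 ltW.
  have s1 : \sum_(y : outcomes g) outcome_pmf theta y = 1.
    exact: (bits_pmf_sum1 (fun e : {e | e \in g} => btl_prob theta (val e))).
  set B := 4 * _ * _.
  apply: (@le_trans _ _ (B * (\sum_(y : outcomes g) outcome_pmf theta y) + 2 * c *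
    (\sum_(y : outcomes g) outcome_pmf theta y * sqnorm2 (loss_gradient y theta) +
     V * \sum_(y : outcomes g) outcome_pmf theta y))).
    rewrite le_eqVlt; apply/orP; left; apply/eqP.
    rewrite !mulr_sumr -!big_split /= mulr_sumr -big_split /=.
    by apply: eq_bigr => y _; ring.
  rewrite s1 !mulr1 lerD2l; apply: ler_wpM2l => //; rewrite lerD2r.
  exact: gradient_mean_square.
have sg : \sum_(g : graph m.+2) graph_pmf p g = 1 by exact: subset_pmf_sum1.
apply: (@le_trans _ _ (4 * m.+2%:R * (\sum_(g : graph m.+2) graph_pmf p g *
     (lambda2 (laplacian R g) < T)%R%:R) +
   2 * c * (\sum_(g : graph m.+2) graph_pmf p g * #|g|%:R +
     V * \sum_(g : graph m.+2) graph_pmf p g))).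
  rewrite le_eqVlt; apply/orP; left; apply/eqP.
  rewrite !mulr_sumr -!big_split /= mulr_sumr -big_split /=.
  by apply: eq_bigr => g _; ring.
rewrite sg mulr1; apply: lerD.
  rewrite [X in _ <= _ * X]big_mkcond /= le_eqVlt; apply/orP; left; apply/eqP.
  by congr (_ * _); apply: eq_bigr => g _; case: ifP; rewrite ?mulr1 ?mulr0.
apply: ler_wpM2l => //; rewrite lerD2r.
rewrite (subset_card_mean _ p); apply: ler_wpM2l; first exact: ltW.
by rewrite -natrM ler_nat card_edge_le.
Qed.
End Risk.

(** * Privacy and risk of the estimator *)
Theorem theorem4p2 (R : realType) :
  exists C1 C : R, 0 < C1 /\ 0 < C /\
  forall (n : nat) (p eps : R), (2 <= n)%N ->
    C1 * ln n%:R / n%:R <= p -> p < 1 -> 0 < eps -> eps < 1 ->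
  forall (d : measure_display) (Om : measurableType d) (Q : probability Om R)
    (W : 'I_n -> {RV Q >-> R}),
    mutually_independent W ->
    (forall i, has_density (W i) (laplace_pdf eps)) ->
    let M := btl_mechanism p (fun i => W i) in
    edge_level_dp Q eps 0 M /\
    (ereal_sup [set risk Q p theta M | theta in @Theta R n] <=
      (C * (p^-1 + Num.min n%:R (n%:R * p ^+ 2 * eps ^+ 2)^-1))%:E)%E.
Proof.
pose k := kappa0 R * expR (- 1).
have k0 : 0 < k by rewrite mulr_gt0 ?kappa0_gt0 ?expR_gt0.
pose K1 := 32 / k ^+ 2.
have K10 : 0 < K1 by rewrite divr_gt0 ?exprn_gt0.
exists (20 ^+ 3), (4 + 64 * K1); split; first by rewrite exprn_gt0.
split; first by lra.
move=> n p eps n2 hp p1 eps0 _ d Om Q W Wind Wdens M.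
have n0 : 0 < n%:R :> R by rewrite ltr0n (leq_trans _ n2).
have p0 : 0 < p.
  apply: lt_le_trans hp; rewrite divr_gt0// mulr_gt0 ?exprn_gt0//.
  by apply: lt_le_trans (ln_nat_ge R n2); rewrite invr_gt0.
have small := lambda2_small_prob n2 hp (ltW p1).
rewrite {}/M; clear hp.
case: n n2 n0 small W Wind Wdens => [//|[//|m]] n2 n0 small W Wind Wdens.
split; first exact: (estimator_private Wind p0 eps0 Wdens).
apply: ge_ereal_sup => _ [theta ht <-].
set n := m.+2%:R in n0 small *.
have pV : 1 <= p^-1 by rewrite invf_ge1 ?ltW.
set B := (n * p ^+ 2 * eps ^+ 2)^-1.
have B0 : 0 < B by rewrite invr_gt0 !mulr_gt0 ?exprn_gt0.
(* When n is the smaller term of the minimum, the diameter bound suffices. *)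
have [nB|Bn] := leP n B.
  apply: le_trans (risk_bound_trivial W p0 (ltW p1) ht) _.
  rewrite lee_fin -/n.
  have : 0 <= K1 * n by rewrite mulr_ge0 ?ltW.
  have : 0 <= K1 * p^-1 by rewrite mulr_ge0 ?ltW// (lt_le_trans _ pV).
  lra.
apply: le_trans (risk_bound_good p0 (ltW p1) eps0 Wdens ht) _.
rewrite lee_fin -/n.
(* Graphs with small lambda2 have probability at most 1/n, so they contribute
   at most 4, and 4 <= 4/p. *)
have h1 : 4 * n * (\sum_(g : graph m.+2 | lambda2 (laplacian R g) < expR (- 1) * n * p) graph_pmf p g) <= 4 * p^-1.
  apply: (@le_trans _ _ (4 * n * n^-1)); first by rewrite ler_wpM2l// mulr_ge0// ltW.
  by rewrite -mulrA mulfV ?gt_eqF// ler_pM2l.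
have -> : 2 * (16 / (kappa0 R * (expR (- 1) * n * p)) ^+ 2) *
    (p * (n * n) + n * (64 / eps ^+ 2)) = K1 * p^-1 + 64 * K1 * B.
  rewrite /K1 /B /k; field.
  by rewrite !gt_eqF ?kappa0_gt0 ?expR_gt0.
have : 0 <= K1 * p^-1 by rewrite mulr_ge0 ?ltW// (lt_le_trans _ pV).
move: h1; set P := 4 * n * _; lra.
Qed.
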